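(* Let $p,q\ge 1$ be integers and $n=p+q$. The orbit of the identity $(\mathbb{I}_n,0)\in SE(n)$ under the $\sigma$-twisted conjugation action, $$ \mathcal S_p=SE(n)\bullet(\mathbb{I}_n,0)=\{(AJ_{p,q}A^{-1}J_{p,q},\,X-AJ_{p,q}A^{-1}X)\,\vert\,(A,X)\in SE(n)\}, $$ is isomorphic to $SE(n)/SE(n)^{\sigma}$ as an $SE(n)$-space (that is, there is an $SE(n)$-equivariant diffeomorphism between them), where $SE(n)$ acts on $\mathcal S_p$ by the $\sigma$-twisted conjugation action and on $SE(n)/SE(n)^\sigma$ by left translations. Furthermore, $\mathcal S_p$ is equal to the connected component of $\mathcal Q$ containing the identity $(\mathbb{I}_n,0)$, and $\mathcal S_p$ is equal to the image $\exp(\mathfrak d_p)$ of $\mathfrak d_p$ under the exponential mapping $\exp: se(n)\to SE(n)$.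
   Context: $SE(n)=SO(n)\otimes_s\mathbb{R}^n$ (semidirect product) is the Lie group of pairs $(R,X)$, $R\in SO(n)$, $X\in\mathbb{R}^n$, identified with the matrices $\begin{pmatrix}R&X\\0&1\end{pmatrix}$, so that $(R_1,X_1)\cdot(R_2,X_2)=(R_1R_2,X_1+R_1X_2)$. Its Lie algebra $se(n)$ consists of pairs $(\omega,v)$, $\omega\in so(n)$, $v\in\mathbb{R}^n$, identified with $\begin{pmatrix}\omega&v\\0&0\end{pmatrix}$. $J_{p,q}=\begin{pmatrix}-\mathbb{I}_p&0\\0&\mathbb{I}_q\end{pmatrix}$, where $\mathbb{I}_k$ is the $k\times k$ identity matrix. The involutive automorphism $\sigma:SE(n)\to SE(n)$ is $\sigma((R,X))=(J_{p,q}RJ_{p,q},J_{p,q}X)$, and $SE(n)^\sigma$ is its subgroup of fixed points. The $\sigma$-twisted conjugation action of $SE(n)$ on itself is $g\bullet h=g\cdot h\cdot\sigma(g^{-1})$; explicitly $(A,X)\bullet(R,Y)=(ARJ_{p,q}A^{-1}J_{p,q},\,X+AY-ARJ_{p,q}A^{-1}X)$. The orbit $\mathcal S_p$ is regarded as a submanifold of $SE(n)$. $\mathcal Q=\{g\in SE(n)\,\vert\,\sigma(g)=g^{-1}\}$; it is preserved by the action $\bullet$. $E_1,\dots,E_n$ is the standard basis of $\mathbb{R}^n$, and $E_i\wedge E_j=E_iE_j^T-E_jE_i^T\in so(n)$ (the overall sign convention is irrelevant here). Put $\mathfrak d_p^0=\mathrm{span}\{E_i\wedge E_j\,\vert\,1\le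 i\le p<j\le n\}\subset so(n)$ and $\mathfrak d_p=\{(\omega,v)\in se(n)\,\vert\,\omega\in\mathfrak d_p^0,\ v\in\mathrm{span}\{E_1,\dots,E_p\}\}\cong\mathfrak d_p^0\oplus\mathbb{R}^p$, which is the $(-1)$-eigenspace of the differential $d\sigma$ at the identity. *)

(* Defs.v *)
From HB Require Import structures.
From mathcomp Require Import all_boot all_order all_algebra.
From mathcomp Require Import generic_quotient.
From mathcomp Require Import all_classical all_reals all_analysis.

Set Implicit Arguments.
Unset Strict Implicit.
Unset Printing Implicit Defensive.

Import Order.TTheory GRing.Theory Num.Theory.
Import numFieldNormedType.Exports.

Local Open Scope classical_set_scope.
Local Open Scope quotient_scope.
Local Open Scope ring_scope.

(* Smooth structures.

   A smooth structure on a topological space is presented by its sheaf of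
   smooth real-valued functions: [C U f] means that [f] restricts to a smooth
   function on the open set [U]; the values of [f] outside of [U] are
   irrelevant. Accordingly, a diffeomorphism is a homeomorphism which identifies
   the two sheaves. *)

Definition smooth_structure (R : realType) (M : Type) :=
  set M -> (M -> R) -> Prop.

(* C^k on an open set [U] of a finite-dimensional space: [f] is C^(k+1) iff it
   is (Frechet) differentiable and all its directional derivatives are C^k. *)
Fixpoint Ck (R : realType) (V : normedModType R) (k : nat) (U : set V)
    (f : V -> R) : Prop :=
  match k with
  | 0%N => forall x, U x -> {for x, continuous f}
  | k'.+1 => (forall x, U x -> differentiable f x) /\
             (forall v : V, Ck k' U ('D_v f))
  end.

Definition vect_smooth (R : realType) (V : normedModType R) :
  smooth_structure R V := fun U f => forall k, Ck k U f.

(* The structure of a submanifold [i : N -> M] of [M]: the smooth functions are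
   those which extend locally to smooth functions on open subsets of [M]. *)
Definition sub_smooth (R : realType) (M : topologicalType) (N : Type)
    (C : smooth_structure R M) (i : N -> M) : smooth_structure R N :=
  fun U f => forall x, U x -> exists (W : set M) (g : M -> R),
    [/\ open W, W (i x), C W g & forall y, U y -> W (i y) -> f y = g (i y)].

(* The structure of a quotient manifold, that is, the one for which the
   projection [pi : M -> N] is a smooth submersion. *)
Definition quot_smooth (R : realType) (M N : Type)
    (C : smooth_structure R M) (pi : M -> N) : smooth_structure R N :=
  fun U f => C (pi @^-1` U) (f \o pi).

Definition diffeomorphism (R : realType) (M N : topologicalType)
    (CM : smooth_structure R M) (CN : smooth_structure R N) (F : M -> N) :=
  [/\ continuous F,
      exists G : N -> M, [/\ cancel F G, cancel G F & continuous G] &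
      forall (U : set N) (f : N -> R), open U ->
        (CN U f <-> CM (F @^-1` U) (f \o F))].


Definition SO_set (R : realType) (n : nat) : set 'M[R]_n :=
  [set A | A *m A^T = 1%:M /\ \det A = 1].

Definition SE_set (R : realType) (n : nat) : set ('M[R]_n * 'cV[R]_n) :=
  [set g | SO_set g.1].

(* As a [set_type], SE(n) carries the topology induced by the ambient vector
   space of pairs (matrix, vector). *)
Definition SE (R : realType) (n : nat) : Type := set_type (@SE_set R n).

HB.instance Definition _ (R : realType) (n : nat) :=
  Topological.copy (SE R n) (set_type (@SE_set R n)).

Section SEgroup.
Variables (R : realType) (n : nat).
Implicit Types (A : 'M[R]_n) (g h : SE R n).

Definition pair_of g : 'M[R]_n * 'cV[R]_n := \val g.
Definition SE_rot g : 'M[R]_n := (pair_of g).1.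
Definition SE_trans g : 'cV[R]_n := (pair_of g).2.

Definition mkSE A (X : 'cV[R]_n) (hA : SO_set A) : SE R n :=
  exist _ (A, X) (mem_set (hA : SE_set (A, X))).

Lemma rot_SO g : SO_set (SE_rot g).
Proof. by case: g => x hx; exact: set_mem hx. Qed.

Lemma SE_eq g h : SE_rot g = SE_rot h -> SE_trans g = SE_trans h -> g = h.
Proof.
by move=> e1 e2; apply: val_inj; apply: injective_projections; [exact: e1|exact: e2].
Qed.

Lemma SO_set1 : SO_set (1%:M : 'M[R]_n).
Proof. by split; rewrite ?trmx1 ?mulmx1 ?det1. Qed.

Lemma SO_setM A B : SO_set A -> SO_set B -> SO_set (A *m B).
Proof.
move=> [hA dA] [hB dB]; split; last by rewrite det_mulmx dA dB mulr1.
by rewrite trmx_mul mulmxA -(mulmxA A B) hB mulmx1 hA.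
Qed.

Lemma SO_setT A : SO_set A -> SO_set A^T.
Proof.
by move=> [hA dA]; split; rewrite ?det_tr// trmxK; exact: mulmx1C.
Qed.

Definition SE_one : SE R n := mkSE 0 SO_set1.
Definition SE_mul g h : SE R n :=
  mkSE (SE_trans g + SE_rot g *m SE_trans h) (SO_setM (rot_SO g) (rot_SO h)).
Definition SE_inv g : SE R n :=
  mkSE (- ((SE_rot g)^T *m SE_trans g)) (SO_setT (rot_SO g)).

Lemma SE_mulA : associative SE_mul.
Proof.
move=> g h k; apply: SE_eq; rewrite /SE_rot /SE_trans /=; first by rewrite mulmxA.
by rewrite mulmxDr addrA mulmxA.
Qed.

Lemma SE_mul1 : left_id SE_one SE_mul.
Proof. by move=> g; apply: SE_eq; rewrite /SE_rot /SE_trans/= ?mul1mx ?add0r. Qed.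

Lemma SE_mulr1 : right_id SE_one SE_mul.
Proof. by move=> g; apply: SE_eq; rewrite /SE_rot /SE_trans/= ?mulmx1 ?mulmx0 ?addr0. Qed.

Lemma SE_mulV : left_inverse SE_one SE_inv SE_mul.
Proof.
move=> g; have [/mulmx1C h _] := rot_SO g.
by apply: SE_eq; rewrite /SE_rot /SE_trans/= ?h ?addNr.
Qed.

Lemma SE_mulrV : right_inverse SE_one SE_inv SE_mul.
Proof.
move=> g; have [h _] := rot_SO g.
apply: SE_eq; rewrite /SE_rot /SE_trans/= ?h// mulmxN mulmxA.
by rewrite (h : (pair_of g).1 *m _ = _) mul1mx subrr.
Qed.

HB.instance Definition _ :=
  isGroup.Build (SE R n) SE_mulA SE_mul1 SE_mulr1 SE_mulV SE_mulrV.

Definition SE_smooth : smooth_structure R (SE R n) :=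
  sub_smooth (@vect_smooth R ('M[R]_n * 'cV[R]_n)%type) pair_of.

Definition SE_mx g : 'M[R]_(n + 1) := block_mx (SE_rot g) (SE_trans g) 0 1%:M.

Definition se_mx (x : 'M[R]_n * 'cV[R]_n) : 'M[R]_(n + 1) :=
  block_mx x.1 x.2 0 0.

Definition expmx (m : nat) (A : 'M[R]_m) : 'M[R]_m :=
  limn (series (fun k => (k`!%:R)^-1 *: A ^+ k)).

End SEgroup.


Section Involution.
Variables (R : realType) (p q : nat).
Local Notation n := (p + q)%N.
Local Notation G := (SE R n).
Implicit Types (g h x y : G).

Definition Jpq : 'M[R]_n := block_mx (- 1%:M) 0 0 1%:M.

Lemma JpqK : Jpq *m Jpq = 1%:M.
Proof.
rewrite mulmx_block !mulmx0 !mul0mx !addr0 !add0r mulmxN mulNmx opprK !mulmx1.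
by rewrite -scalar_mx_block.
Qed.

Lemma tr_Jpq : Jpq^T = Jpq.
Proof. by rewrite tr_block_mx linearN/= !trmx1 !trmx0. Qed.

Lemma SO_setJ A : SO_set A -> SO_set (Jpq *m A *m Jpq).
Proof.
move=> [hA dA]; split.
  rewrite !trmx_mul tr_Jpq -!mulmxA (mulmxA Jpq Jpq) JpqK mul1mx.
  by rewrite (mulmxA A) hA mul1mx JpqK.
by rewrite !det_mulmx dA mulr1 -det_mulmx JpqK det1.
Qed.

Definition sigma g : G := mkSE (Jpq *m SE_trans g) (SO_setJ (rot_SO g)).

Definition SE_sigma : set G := [set g | sigma g = g].

Lemma sigmaM g h : sigma (g * h)%g = (sigma g * sigma h)%g.
Proof.
apply: SE_eq => /=.
  rewrite -[RHS]/(Jpq *m SE_rot g *m Jpq *m (Jpq *m SE_rot h *m Jpq)).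
  rewrite -[LHS]/(Jpq *m (SE_rot g *m SE_rot h) *m Jpq).
  by rewrite -!mulmxA (mulmxA Jpq Jpq) JpqK mul1mx.
rewrite -[LHS]/(Jpq *m (SE_trans g + SE_rot g *m SE_trans h)).
rewrite -[RHS]/(Jpq *m SE_trans g + Jpq *m SE_rot g *m Jpq *m (Jpq *m SE_trans h)).
by rewrite mulmxDr -!mulmxA (mulmxA Jpq Jpq) JpqK mul1mx.
Qed.

Lemma sigma1 : sigma 1%g = 1%g.
Proof.
by apply: SE_eq; rewrite /SE_rot /SE_trans /= ?mulmx1 ?JpqK ?mulmx0.
Qed.

Lemma sigmaV g : sigma g^-1%g = (sigma g)^-1%g.
Proof.
by apply: (@mulgI _ (sigma g)); rewrite -sigmaM !mulgV sigma1.
Qed.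

Definition twisted g h : G := (g * h * sigma g^-1)%g.

Definition Sp : set G := [set twisted g 1%g | g in [set: G]].

Definition Sp_smooth : smooth_structure R (set_type Sp) :=
  sub_smooth (@SE_smooth R n) (\val : set_type Sp -> G).

Definition Qset : set G := [set g | sigma g = g^-1%g].


Definition coset_rel x y : bool := `[< SE_sigma (x^-1 * y)%g >].

Lemma coset_rel_refl : reflexive coset_rel.
Proof. by move=> x; apply/asboolP; rewrite /SE_sigma/= mulVg sigma1. Qed.

Lemma coset_rel_sym : symmetric coset_rel.
Proof.
have H x y : coset_rel x y -> coset_rel y x.
  move=> /asboolP /= e; apply/asboolP => /=.
  by rewrite /SE_sigma/= -[X in sigma X]invgK sigmaV invgM invgK e invgM invgK.
by move=> x y; apply/idP/idP; exact: H.
Qed.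

Lemma coset_rel_trans : transitive coset_rel.
Proof.
move=> y x z /asboolP /= e1 /asboolP /= e2; apply/asboolP => /=.
have -> : (x^-1 * z = (x^-1 * y) * (y^-1 * z))%g by rewrite mulgA mulgK.
by rewrite /SE_sigma/= sigmaM e1 e2.
Qed.

Canonical coset_equiv :=
  EquivRel coset_rel coset_rel_refl coset_rel_sym coset_rel_trans.

Definition homog : Type := quotient_topology {eq_quot coset_equiv}.

HB.instance Definition _ :=
  Topological.copy homog (quotient_topology {eq_quot coset_equiv}).

Definition homog_pi : G -> homog := \pi_{eq_quot coset_equiv}.

Definition homog_smooth : smooth_structure R homog :=
  quot_smooth (@SE_smooth R n) homog_pi.

Definition left_translation g (C : homog) : homog :=
  homog_pi (g * repr (C : {eq_quot coset_equiv}))%g.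

Lemma left_translationE g h :
  left_translation g (homog_pi h) = homog_pi (g * h)%g.
Proof.
apply/eqmodP/asboolP => /=.
have /eqmodP/asboolP/= : \pi_{eq_quot coset_equiv} (repr (homog_pi h)) =
  \pi_{eq_quot coset_equiv} h by rewrite reprK.
by rewrite invgM -mulgA (mulgA _ g h) mulVg mul1g.
Qed.


Definition basis_vec (i : 'I_n) : 'cV[R]_n := delta_mx i 0.

Definition wedge (i j : 'I_n) : 'M[R]_n :=
  basis_vec i *m (basis_vec j)^T - basis_vec j *m (basis_vec i)^T.

Definition dp0 : {vspace 'M[R]_n} :=
  <<[seq wedge (lshift q i) (rshift p j) | i <- enum 'I_p, j <- enum 'I_q]>>%VS.

Definition dp : set ('M[R]_n * 'cV[R]_n) :=
  [set x | x.1 \in dp0 /\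
           x.2 \in <<[seq basis_vec (lshift q i) | i <- enum 'I_p]>>%VS].

End Involution.

Arguments SE_set : clear implicits.
Arguments Jpq : clear implicits.
Arguments Sp : clear implicits.
Arguments Qset : clear implicits.
Arguments dp : clear implicits.
Arguments homog : clear implicits.
Arguments SE_smooth : clear implicits.
Arguments Sp_smooth : clear implicits.
Arguments homog_smooth : clear implicits.

(* Main.v *)
Require Import Defs.
From mathcomp Require Import all_boot all_order all_algebra.
From mathcomp Require Import generic_quotient.
From mathcomp Require Import all_classical all_reals all_analysis.
From mathcomp Require Import ring lra complex.

(** Write [J] for [Jpq], and [B = R J] for the [reflection] of [g = (R, Y)].
    The condition [sigma g = g^-1] says that [B] is a symmetric involution
    with [B Y = - Y]. The orbit consists of those [g] for which, moreover,
    [B = A J A^T] with [A] in SO(n): such a [g] is the image of [(A, Y / 2)]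
    under [g |-> twisted g 1], because [Y / 2 - B (Y / 2) = Y]. This is [SpP];
    it reduces everything to the conjugation of symmetric involutions.

    Conjugating involutions. If [C] is invertible and [B C = C J], then [C] can
    be orthonormalized without losing this relation: with [U] the inverse
    Cholesky factor of [C^T C], the matrix [A = C U^T] is orthogonal and still
    intertwines [J] and [B], since [C^T C], and therefore [U], commutes with the
    diagonal matrix [J] ([orthonormalize_intertwine]). This is used twice.
    For two symmetric involutions [B], [B'] with [1 + B B'] invertible, the
    matrix [1 + B B'] intertwines [B'] and [B]; hence the orbit is open and
    closed in Q ([Sp_of_close]). And near the identity [C = (1 + R) / 2]
    intertwines [J] and [B], so that [C U^T] is an explicit section of the orbit
    map. The entries of [U] are obtained by ring operations and inverse square
    roots of positive functions, so the section is smooth; translating it gives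
    smooth local sections everywhere ([local_section]). They make the orbit map
    open, and they express a function on the orbit as the composition of
    its pullback to SE(n) with a smooth map; this is the diffeomorphism.

    The exponential. A singular value decomposition brings an element of the
    Lie algebra part [dp0] to the form [sum_i th_i E_i], where the [E_i] are
    the infinitesimal rotations of pairwise orthogonal planes, each spanned by
    one vector of either eigenspace of [J] ([lie_normal_form]). The matrices
    [planar_mx d b a] multiply like tuples of complex numbers [b_i + i a_i], one
    for each plane, together with the number [d] on the orthogonal complement
    of the planes ([planar_mxM]), so the exponential series is computed in
    each plane separately: its rotation part is [e^(i th)], its translation part
    is [(e^(i th) - 1) / (i th)] applied to [v] ([expmx_planar]). The first is
    the image under the orbit map of the rotation by [th / 2], so [exp (dp)] lies
    in the orbit. Conversely, [A J A^T J] is the product of the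
    rotations by [2 phi_i], where the [cos phi_i] are, up to sign, the singular
    values of the upper left block of [A] ([group_normal_form]); planes with [sin phi_i = 0]
    can be dropped, hence [0 < 2 phi_i < 2 pi], the translation factor is
    invertible, and [v] can be solved for. Letting the angles run from [0] to
    [phi_i] joins every point of the orbit to the identity ([Sp_path]), so that
    the orbit is connected. *)

Set Implicit Arguments.
Unset Strict Implicit.
Unset Printing Implicit Defensive.
Import Order.TTheory GRing.Theory Num.Theory.
Import numFieldNormedType.Exports.
Local Open Scope classical_set_scope.
Local Open Scope quotient_scope.
Local Open Scope ring_scope.

(** * Functions of class C^k *)

Section Calculus.
Variable R : realType.
Implicit Types V : normedModType R.

(** Together with the corresponding fact on directional derivatives, this makes
    the class C^k on an open set a property of the restriction to that set. *)
Lemma near_eq_differentiable V (f g : V -> R) x :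
  (\forall y \near x, f y = g y) -> differentiable f x -> differentiable g x.
Proof.
move=> fg df.
have fgx : f x = g x := nbhs_singleton fg.
have H : g \o shift x = cst (g x) + 'd f x +o_ 0 id.
  apply/eqaddoP => e e0.
  have /eqaddoP/(_ _ e0) H0 := diff_locally df.
  have fg0 : \forall y \near (0 : V), f (y + x) = g (y + x).
    by move: fg; rewrite (near_shift 0) subr0.
  by apply: filterS2 H0 fg0 => y /=; rewrite -fgx !fctE /= => + <-.
have dE : 'd g x = 'd f x :> (V -> R).
  by apply: (diff_unique _ H); exact: diff_continuous.
apply/diff_locallyP; rewrite dE; split; last exact: H.
exact: diff_continuous.
Qed.

Lemma Ck_congr V (U : set V) (f g : V -> R) k :
  open U -> (forall x, U x -> f x = g x) -> Ck k U f -> Ck k U g.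
Proof.
move=> oU; elim: k f g => [|k IH] f g fg /=.
  move=> cf x Ux; rewrite /prop_for /continuous_at -(fg _ Ux).
  apply: cvg_trans (cf _ Ux); apply: near_eq_cvg.
  by apply: filterS (open_nbhs_nbhs (conj oU Ux)) => y /fg.
move=> [df Df].
have nfg x : U x -> \forall y \near x, f y = g y.
  by move=> Ux; apply: filterS (open_nbhs_nbhs (conj oU Ux)) => y /fg.
split=> [x Ux|v].
  exact: near_eq_differentiable (nfg x Ux) (df x Ux).
by apply: IH (Df v) => x Ux; exact/near_eq_derive/nfg.
Qed.

Lemma Ck_sub V (U U' : set V) (f : V -> R) k : U' `<=` U -> Ck k U f -> Ck k U' f.
Proof.
move=> sU; elim: k f => [|k IH] f /=; first by move=> H x /sU /H.
by move=> [H1 H2]; split=> [x /sU /H1//|v]; exact: IH.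
Qed.

Lemma Ck_pred V (U : set V) (f : V -> R) k : Ck k.+1 U f -> Ck k U f.
Proof.
elim: k f => [|k IH] f /= [H1 H2].
  by move=> x Ux; exact/differentiable_continuous/H1.
by split=> // v; exact/IH/H2.
Qed.

Lemma Ck_cst V (U : set V) (a : R) k : Ck k U (cst a).
Proof.
elim: k a => [|k IH] a /=; first by move=> x _; exact: cvg_cst.
split=> [x _|v]; first exact: differentiable_cst.
have -> : 'D_v (cst a : V -> R) = cst 0 by apply/funext => x; exact: derive_cst.
exact: IH.
Qed.

Lemma CkD V (U : set V) (f g : V -> R) k :
  open U -> Ck k U f -> Ck k U g -> Ck k U (f + g).
Proof.
move=> oU; elim: k f g => [|k IH] f g /=.
  by move=> cf cg x Ux; apply: continuousD; [exact: cf|exact: cg].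
move=> [df Df] [dg Dg]; split=> [x Ux|v].
  by apply: differentiableD; [exact: df|exact: dg].
apply: Ck_congr (IH _ _ (Df v) (Dg v)) => // x Ux.
by rewrite deriveD//; apply: diff_derivable; [exact: df|exact: dg].
Qed.

Lemma CkM V (U : set V) (f g : V -> R) k :
  open U -> Ck k U f -> Ck k U g -> Ck k U (f * g).
Proof.
move=> oU; elim: k f g => [|k IH] f g.
  by move=> /= cf cg x Ux; apply: continuousM; [exact: cf|exact: cg].
move=> Cf Cg; have [df Df] := Cf; have [dg Dg] := Cg; split=> [x Ux|v].
  by apply: differentiableM; [exact: df|exact: dg].
have : Ck k U (f * 'D_v g + g * 'D_v f).
  by apply: CkD => //; apply: IH; solve [exact: Ck_pred|exact: Dg|exact: Df].
apply: Ck_congr => // x Ux.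
by rewrite deriveM//; apply: diff_derivable; [exact: df|exact: dg].
Qed.

Lemma Ck_lin V (U : set V) (f : {linear V -> R}) k : continuous f -> Ck k U f.
Proof.
move=> cf; case: k => [|k] /=; first by move=> x _; exact: cf.
split=> [x _|v]; first exact: (@linear_differentiable _ _ _ f x cf).
have -> : 'D_v f = cst (f v).
  apply/funext => x; rewrite deriveE; last exact: (@linear_differentiable _ _ _ f x cf).
  by rewrite diff_lin.
exact: Ck_cst.
Qed.

(** The derivative of [t^(-1/2)] is a polynomial in [t^(-1/2)], which is why the
    induction of [Ck_rsqrt] closes on this single function; it provides inverses
    of positive functions as well, as squares. *)
Lemma is_diff_rsqrt V (f : V -> R) x : 0 < f x -> differentiable f x ->
  is_diff x (fun y => (Num.sqrt (f y))^-1)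
    ((- 2^-1 * (Num.sqrt (f x))^-1 ^+ 3) *: ('d f x : V -> R)).
Proof.
move=> fx0 df.
have s0 : Num.sqrt (f x) != 0 by rewrite gt_eqF// sqrtr_gt0.
have D : is_derive (f x) 1 (fun t => (Num.sqrt t)^-1)
    (- 2^-1 * (Num.sqrt (f x))^-1 ^+ 3).
  have [D1 D2] := is_derive1_sqrt fx0.
  split; first by apply: derivableV.
  rewrite deriveV// D2 -exprVn expr2 exprS expr2 invfM.
  by rewrite /GRing.scale /=; field.
have dd : differentiable (fun t => (Num.sqrt t)^-1) (f x).
  by apply/derivable1_diffP; case: D.
have -> : (fun y => (Num.sqrt (f y))^-1) = (fun t => (Num.sqrt t)^-1) \o f by [].
split; first exact: differentiable_comp.
rewrite diff_comp// ; apply/funext => v /=.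
rewrite diff1E// derive1E; case: D => _ ->.
by rewrite [RHS]mulrC.
Qed.

Lemma Ck_rsqrt V (U : set V) (f : V -> R) k : open U ->
  (forall x, U x -> 0 < f x) -> Ck k U f ->
  Ck k U (fun y => (Num.sqrt (f y))^-1).
Proof.
move=> oU f0; elim: k => [|k IH].
  move=> /= cf x Ux; apply: continuousV; first by rewrite gt_eqF// sqrtr_gt0 f0.
  apply: (@continuous_comp _ _ _ f Num.sqrt); first exact: cf.
  exact: sqrt_continuous.
move=> Cf; have [df Df] := Cf; split=> [x Ux|v].
  by have [] := is_diff_rsqrt (f0 _ Ux) (df _ Ux).
pose h y := (Num.sqrt (f y))^-1.
have Ch : Ck k U h by exact/IH/Ck_pred.
have : Ck k U (cst (- 2^-1) * (h * (h * h)) * 'D_v f).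
  apply: CkM; [by []| |exact: Df].
  by apply: CkM; [by []|exact: Ck_cst|do 2?apply: CkM].
apply: Ck_congr => // x Ux.
have [d1 d2] := is_diff_rsqrt (f0 _ Ux) (df _ Ux).
rewrite deriveE// d2 !fctE deriveE; last exact: df.
by rewrite /h !exprS expr0 mulr1.
Qed.

Lemma CkN V (U : set V) (f : V -> R) k : open U -> Ck k U f -> Ck k U (- f).
Proof.
move=> oU Cf; have : Ck k U (cst (-1) * f) by apply: CkM => //; exact: Ck_cst.
by apply: Ck_congr => // x _; rewrite !fctE mulN1r.
Qed.

Lemma Ck_sum V (U : set V) (I : Type) (r : seq I) (P : pred I) (f : I -> V -> R) k :
  open U -> (forall i, Ck k U (f i)) -> Ck k U (fun x => \sum_(i <- r | P i) f i x).
Proof.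
move=> oU Cf; elim: r => [|i r IH].
  have -> : (fun x : V => \sum_(i <- [::] | P i) f i x) = cst 0.
    by apply/funext => x; rewrite big_nil.
  exact: Ck_cst.
case Pi : (P i); last first.
  by apply: Ck_congr IH => // x _; rewrite big_cons Pi.
by apply: Ck_congr (CkD oU (Cf i) IH) => // x _; rewrite big_cons Pi.
Qed.

(** The chain rule for an inner map given by its coordinates on vectors [e i]:
    the derivative of [h (S x)] along [v] is the sum of the products of
    [D_v (s i)] with [D_(e i) h (S x)], to which the induction hypothesis
    applies. *)
Lemma Ck_comp V V' (U : set V) (W : set V') (I : finType) (s : I -> V -> R)
    (e : I -> V') (h : V' -> R) k :
  open U -> (forall i, Ck k U (s i)) -> Ck k W h ->
  (forall x, U x -> W (\sum_i s i x *: e i)) ->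
  Ck k U (fun x => h (\sum_i s i x *: e i)).
Proof.
move=> oU + + UW; pose S x := \sum_i s i x *: e i.
have dS x : (forall i, differentiable (s i) x) ->
    is_diff x S (fun v => \sum_i 'd (s i) x v *: e i).
  move=> ds; rewrite /S.
  elim: (index_enum I) => [|i r [IH1 IH2]].
    have -> : (fun x0 => \sum_(i <- [::]) s i x0 *: e i) = cst 0.
      by apply/funext => y; rewrite big_nil.
    split; first exact: differentiable_cst.
    by rewrite diff_cst; apply/funext => y; rewrite big_nil.
  have -> : (fun x0 => \sum_(j <- i :: r) s j x0 *: e j) =
     (fun x0 => s i x0 *: e i) + (fun x0 => \sum_(j <- r) s j x0 *: e j).
    by apply/funext => y; rewrite big_cons.
  have d1 : differentiable (fun x0 => s i x0 *: e i) x.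
    exact: differentiableZl.
  split; first exact: differentiableD.
  rewrite diffD// IH2 diffZl//; apply/funext => y.
  by rewrite big_cons.
elim: k h => [|k IH] h.
  move=> /= cs ch x Ux; apply: (@continuous_comp _ _ _ S h); last exact/ch/UW.
  rewrite /S; apply: cvg_big => [|i _].
    exact: add_continuous.
  by apply: cvgZr_tmp; exact: cs.
move=> Cs Ch; have [dh Dh] := Ch.
have ds i x : U x -> differentiable (s i) x by move=> Ux; case: (Cs i) => H _; exact: H.
split=> [x Ux|v].
  apply: (@differentiable_comp _ _ _ _ S h); last exact/dh/UW.
  by have [] := dS x (fun i => ds i x Ux).
have : Ck k U (fun x => \sum_i ('D_v (s i) x) * ('D_(e i) h (S x))).
  apply: Ck_sum => // i.
  apply: (@CkM _ _ ('D_v (s i)) (fun x => 'D_(e i) h (S x))) => //.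
    by case: (Cs i) => _ H; exact: H.
  by apply: (IH ('D_(e i) h)) => [j|]; [exact/Ck_pred/Cs|exact: Dh].
apply: Ck_congr => // x Ux.
have [d1 d2] := dS x (fun i => ds i x Ux).
have dhx : differentiable h (S x) by exact/dh/UW.
rewrite deriveE; last exact: (@differentiable_comp _ _ _ _ S h).
rewrite (@diff_comp _ _ _ _ S h)// d2 /= linear_sum; apply: eq_bigr => i _.
by rewrite linearZ/= !deriveE//; exact: ds.
Qed.

End Calculus.

(** * Germs of smooth functions and of matrices of smooth functions *)

Lemma cvg_mx (T : Type) (F : set_system T) (FF : Filter F) (R : realType) m n
    (M : T -> 'M[R]_(m, n)) (L : 'M[R]_(m, n)) :
  (forall i j, (fun t => M t i j) @ F --> L i j) -> M @ F --> L.
Proof.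
move=> cM A [B LB BA].
have H : \forall t \near F, forall i j, B i j (M t i j).
  by apply: filter_forall => i; apply: filter_forall => j; exact/cM/LB.
by apply: filterS H => t Bt; exact: BA.
Qed.

Section SmoothAt.
Variables (R : realType) (V : normedModType R).
Implicit Types (x : V) (f g : V -> R).

Definition smooth_at x f := exists U : set V, [/\ open U, U x & vect_smooth U f].

Lemma smooth_at_continuous x f : smooth_at x f -> {for x, continuous f}.
Proof. by move=> [U [oU Ux /(_ 0%N) /= Cf]]; exact: Cf. Qed.

Lemma smooth_at_cst x (a : R) : smooth_at x (cst a).
Proof. by exists setT; split => // [|k]; [exact: openT|exact: Ck_cst]. Qed.

Lemma smooth_at_lin x (f : {linear V -> R}) : continuous f -> smooth_at x f.
Proof. by move=> cf; exists setT; split => // [|k]; [exact: openT|exact: Ck_lin]. Qed.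

Lemma smooth_atD x f g : smooth_at x f -> smooth_at x g ->
  smooth_at x (fun y => f y + g y).
Proof.
move=> [U [oU Ux Cf]] [W [oW Wx Cg]]; exists (U `&` W); split => //.
  exact: openI.
move=> k; apply: (@CkD _ _ _ f g); first exact: openI.
  exact: Ck_sub (Cf k).
exact: Ck_sub (Cg k).
Qed.

Lemma smooth_atM x f g : smooth_at x f -> smooth_at x g ->
  smooth_at x (fun y => f y * g y).
Proof.
move=> [U [oU Ux Cf]] [W [oW Wx Cg]]; exists (U `&` W); split => //.
  exact: openI.
move=> k; apply: (@CkM _ _ _ f g); first exact: openI.
  exact: Ck_sub (Cf k).
exact: Ck_sub (Cg k).
Qed.

Lemma smooth_atN x f : smooth_at x f -> smooth_at x (fun y => - f y).
Proof.
by move=> [U [oU Ux Cf]]; exists U; split => // k; exact: CkN.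
Qed.

Lemma smooth_at_sum x (I : Type) (r : seq I) (P : pred I) (F : I -> V -> R) :
  (forall i, smooth_at x (F i)) -> smooth_at x (fun y => \sum_(i <- r | P i) F i y).
Proof.
move=> CF; elim: r => [|i r IH].
  under [X in smooth_at _ X]eq_fun do rewrite big_nil.
  exact: smooth_at_cst.
under [X in smooth_at _ X]eq_fun do rewrite big_cons.
by case: (P i) => //; exact: smooth_atD.
Qed.

Lemma smooth_at_prod x (I : Type) (r : seq I) (P : pred I) (F : I -> V -> R) :
  (forall i, smooth_at x (F i)) -> smooth_at x (fun y => \prod_(i <- r | P i) F i y).
Proof.
move=> CF; elim: r => [|i r IH].
  under [X in smooth_at _ X]eq_fun do rewrite big_nil.
  exact: smooth_at_cst.
under [X in smooth_at _ X]eq_fun do rewrite big_cons.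
by case: (P i) => //; exact: smooth_atM.
Qed.

Lemma smooth_at_rsqrt x f : 0 < f x -> smooth_at x f ->
  smooth_at x (fun y => (Num.sqrt (f y))^-1).
Proof.
move=> fx0 [U [oU Ux Cf]].
have cf y : U y -> {for y, continuous f} by exact: (Cf 0%N).
pose W := [set y | U y /\ 0 < f y].
have oW : open W.
  rewrite openE => y [Uy fy0]; apply: filterI.
    exact: open_nbhs_nbhs.
  exact: (cvgr_gt _ (cf y Uy)).
exists W; split => // k; apply: Ck_rsqrt => // [y []//|].
by apply: Ck_sub (Cf k) => y [].
Qed.

Definition smooth_mx_at x m n (M : V -> 'M[R]_(m, n)) :=
  forall i j, smooth_at x (fun y => M y i j).

Section Matrices.
Variable x : V.

Lemma smooth_mx_cst m n (A : 'M[R]_(m, n)) : smooth_mx_at x (fun _ => A).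
Proof. by move=> i j; exact: smooth_at_cst. Qed.

Lemma smooth_mxD m n (A B : V -> 'M[R]_(m, n)) : smooth_mx_at x A ->
  smooth_mx_at x B -> smooth_mx_at x (fun y => A y + B y).
Proof.
move=> sA sB i j; under [X in smooth_at _ X]eq_fun do rewrite mxE.
exact: smooth_atD.
Qed.

Lemma smooth_mxN m n (A : V -> 'M[R]_(m, n)) : smooth_mx_at x A ->
  smooth_mx_at x (fun y => - A y).
Proof.
move=> sA i j; under [X in smooth_at _ X]eq_fun do rewrite mxE.
exact: smooth_atN.
Qed.

Lemma smooth_mxM m n p (A : V -> 'M[R]_(m, n)) (B : V -> 'M[R]_(n, p)) :
  smooth_mx_at x A -> smooth_mx_at x B -> smooth_mx_at x (fun y => A y *m B y).
Proof.
move=> sA sB i j; under [X in smooth_at _ X]eq_fun do rewrite mxE.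
by apply: smooth_at_sum => k; exact: smooth_atM.
Qed.

Lemma smooth_mxZ m n (a : V -> R) (A : V -> 'M[R]_(m, n)) :
  smooth_at x a -> smooth_mx_at x A -> smooth_mx_at x (fun y => a y *: A y).
Proof.
move=> sa sA i j; under [X in smooth_at _ X]eq_fun do rewrite mxE.
exact: smooth_atM.
Qed.

Lemma smooth_mxT m n (A : V -> 'M[R]_(m, n)) : smooth_mx_at x A ->
  smooth_mx_at x (fun y => (A y)^T).
Proof.
by move=> sA i j; under [X in smooth_at _ X]eq_fun do rewrite mxE; exact: sA.
Qed.

Lemma smooth_at_det n (A : V -> 'M[R]_n) : smooth_mx_at x A ->
  smooth_at x (fun y => \det (A y)).
Proof.
move=> sA; apply: smooth_at_sum => s.
by apply: smooth_atM; [exact: smooth_at_cst|apply: smooth_at_prod].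
Qed.

Lemma smooth_mx_block m1 m2 n1 n2 (A : V -> 'M[R]_(m1, n1)) (B : V -> 'M[R]_(m1, n2))
  (C : V -> 'M[R]_(m2, n1)) (D : V -> 'M[R]_(m2, n2)) :
  smooth_mx_at x A -> smooth_mx_at x B -> smooth_mx_at x C -> smooth_mx_at x D ->
  smooth_mx_at x (fun y => block_mx (A y) (B y) (C y) (D y)).
Proof.
move=> sA sB sC sD i j; have [i' ->|i' ->] := split_ordP i; have [j' ->|j' ->] := split_ordP j.
- by under [X in smooth_at _ X]eq_fun do rewrite block_mxEul; exact: sA.
- by under [X in smooth_at _ X]eq_fun do rewrite block_mxEur; exact: sB.
- by under [X in smooth_at _ X]eq_fun do rewrite block_mxEdl; exact: sC.
- by under [X in smooth_at _ X]eq_fun do rewrite block_mxEdr; exact: sD.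
Qed.

End Matrices.
End SmoothAt.

Section PairCoordinates.
Variables (R : realType) (m n k l : nat).
Local Notation V := ('M[R]_(m, n) * 'M[R]_(k, l))%type.

Lemma smooth_mx_fst (x : V) : smooth_mx_at x (fun y : V => y.1).
Proof.
move=> i j.
have @f : {linear V -> R}.
  by exists (fun y : V => y.1 i j); do 2![eexists]; do ?[constructor];
     rewrite ?mxE// => ? *; rewrite ?mxE//; move=> ?; rewrite !mxE.
apply: (@smooth_at_lin _ _ x f) => y.
by apply: (@continuous_comp _ _ _ fst (fun M : 'M[R]_(m, n) => M i j));
  [exact: cvg_fst|exact: coord_continuous].
Qed.

Lemma smooth_mx_snd (x : V) : smooth_mx_at x (fun y : V => y.2).
Proof.
move=> i j.
have @f : {linear V -> R}.
  by exists (fun y : V => y.2 i j); do 2![eexists]; do ?[constructor];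
     rewrite ?mxE// => ? *; rewrite ?mxE//; move=> ?; rewrite !mxE.
apply: (@smooth_at_lin _ _ x f) => y.
by apply: (@continuous_comp _ _ _ snd (fun M : 'M[R]_(k, l) => M i j));
  [exact: cvg_snd|exact: coord_continuous].
Qed.

End PairCoordinates.

Section Germs.
Variables (R : realType) (n : nat).
Local Notation V := ('M[R]_n * 'cV[R]_n)%type.

Lemma smooth_mx_continuous (x : V) k l (M : V -> 'M[R]_(k, l)) :
  smooth_mx_at x M -> {for x, continuous M}.
Proof. by move=> sM; apply: cvg_mx => i j; exact: smooth_at_continuous. Qed.

Lemma smooth_mx_common (x : V) k l (M : V -> 'M[R]_(k, l)) : smooth_mx_at x M ->
  exists W : set V, [/\ open W, W x &
    forall i j, vect_smooth W (fun y => M y i j)].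
Proof.
move=> sM.
pose W i j := sval (cid (sM i j)).
have WP i j : [/\ open (W i j), W i j x & vect_smooth (W i j) (fun y => M y i j)].
  exact: svalP (cid (sM i j)).
pose A := [set y | forall i j, W i j y].
have nA : \forall y \near x, forall i j, W i j y.
  apply: (@filter_forall V _ (fun i y => forall j, W i j y) (nbhs x)) => i.
  apply: (@filter_forall V _ (fun j y => W i j y) (nbhs x)) => j.
  by have [oW Wx _] := WP i j; exact: open_nbhs_nbhs.
exists (interior A); split; [exact: open_interior|exact: nA|].
move=> i j m; have [_ _ sW] := WP i j; apply: Ck_sub (sW m).
by move=> y /interior_subset; exact.
Qed.

Lemma pair_sum_delta (x : V) : x =
  \sum_(i : 'I_n * 'I_n + 'I_n)
    match i with inl kl => x.1 kl.1 kl.2 | inr k => x.2 k 0 end *: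
    match i with inl kl => (delta_mx kl.1 kl.2, 0) | inr k => (0, delta_mx k 0) end.
Proof.
rewrite big_sumType /= -(pair_bigA _ (fun k l => x.1 k l *: ((delta_mx k l, 0) : V))) /=.
have fst_sum (I : finType) (F : I -> V) : (\sum_i F i).1 = \sum_i (F i).1.
  by apply: (big_morph (fun y : V => y.1)).
have snd_sum (I : finType) (F : I -> V) : (\sum_i F i).2 = \sum_i (F i).2.
  by apply: (big_morph (fun y : V => y.2)).
apply: injective_projections => /=.
  rewrite !fst_sum /= [X in _ + X]big1 ?addr0 => [|i _]; last by rewrite scaler0.
  rewrite [LHS]matrix_sum_delta; apply: eq_bigr => i _.
  by rewrite fst_sum.
rewrite !snd_sum /= big1 ?add0r => [|i _]; last by rewrite snd_sum big1// => j _; rewrite /= scaler0.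
by rewrite [LHS]matrix_sum_delta; apply: eq_bigr => i _; rewrite big_ord1.
Qed.

Lemma smooth_pair_continuous (x : V) (S : V -> V) :
  smooth_mx_at x (fun y => (S y).1) -> smooth_mx_at x (fun y => (S y).2) ->
  {for x, continuous S}.
Proof.
move=> s1 s2; rewrite (_ : S = (fun y => ((S y).1, (S y).2))); last first.
  by apply/funext => y; rewrite -surjective_pairing.
exact: (@cvg_pair _ _ _ (nbhs x) (nbhs (S x).1) (nbhs (S x).2) _ _ _ _ _
  (smooth_mx_continuous s1) (smooth_mx_continuous s2)).
Qed.

Lemma smooth_comp (x : V) (S : V -> V) (U : set V) (h : V -> R) :
  smooth_mx_at x (fun y => (S y).1) -> smooth_mx_at x (fun y => (S y).2) ->
  open U -> U (S x) -> vect_smooth U h ->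
  exists W : set V, [/\ open W, W x, W `<=` S @^-1` U & vect_smooth W (h \o S)].
Proof.
move=> s1 s2 oU USx sh.
have [W1 [oW1 W1x sW1]] := smooth_mx_common s1.
have [W2 [oW2 W2x sW2]] := smooth_mx_common s2.
have cS := smooth_pair_continuous s1 s2.
pose W := interior (W1 `&` W2 `&` S @^-1` U).
have Wsub : W `<=` W1 `&` W2 `&` S @^-1` U by exact: interior_subset.
exists W; split.
- exact: open_interior.
- apply: filterI; first by apply: filterI; exact: open_nbhs_nbhs.
  by apply: cS; exact: open_nbhs_nbhs.
- by move=> y /Wsub [].
- move=> k; have oW : open W by exact: open_interior.
  pose s (i : 'I_n * 'I_n + 'I_n) (y : V) : R :=
    match i with inl kl => (S y).1 kl.1 kl.2 | inr k => (S y).2 k 0 end.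
  pose e (i : 'I_n * 'I_n + 'I_n) : V :=
    match i with inl kl => (delta_mx kl.1 kl.2, 0) | inr k => (0, delta_mx k 0) end.
  have Sdelta y : S y = \sum_i s i y *: e i by exact: pair_sum_delta.
  have : Ck k W (fun y => h (\sum_i s i y *: e i)).
    apply: (@Ck_comp R V V W U _ s e h k oW) => [[[a b]|a]|//|y Wy].
    + by apply: Ck_sub (sW1 a b k) => y /Wsub [[]].
    + by apply: Ck_sub (sW2 a 0 k) => y /Wsub [[]].
    + by rewrite -Sdelta; have [] := Wsub _ Wy.
  by apply: Ck_congr => // y Wy; rewrite /= [in RHS]Sdelta.
Qed.

End Germs.

(** * The inverse Cholesky factor *)

Section Cholesky.
Variable R : realType.

(** The lower triangular [U] with [U M U^T = 1]. With [a] the corner of [M] and [b]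
    the rest of its first column, the recursion is on the Schur complement of
    [a]; the number [r] is [a^(-1/2)], and [a^-1] is written [r ^+ 2], so that besides
    ring operations only inverse square roots occur. *)
Fixpoint inv_cholesky n : 'M[R]_n -> 'M[R]_n :=
  match n with
  | 0%N => id
  | n'.+1 => fun M : 'M[R]_(1 + n') =>
      let r := (Num.sqrt (ulsubmx M 0 0))^-1 in
      let b := dlsubmx M in
      let U := inv_cholesky (drsubmx M - r ^+ 2 *: (b *m b^T)) in
      block_mx r%:M 0 (- (r ^+ 2 *: (U *m b))) U
  end.

Definition posdef n (M : 'M[R]_n) :=
  M^T = M /\ forall w : 'cV_n, w != 0 -> 0 < (w^T *m M *m w) 0 0.

Lemma posdef_corner n (M : 'M[R]_(1 + n)) : posdef M -> 0 < ulsubmx M 0 0.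
Proof.
move=> [_ /(_ (col_mx 1%:M 0))].
rewrite -[M in (_ *m M *m _)]submxK tr_col_mx mul_row_block mul_row_col.
rewrite !trmx0 !mul0mx !mulmx0 !addr0 trmx1 mul1mx mulmx1; apply.
by apply/negP => /eqP/matrixP/(_ (lshift _ 0) 0); rewrite col_mxEu !mxE/= => /eqP; rewrite oner_eq0.
Qed.

Lemma sym_block n (M : 'M[R]_(1 + n)) : M^T = M ->
  M = block_mx (ulsubmx M 0 0)%:M (dlsubmx M)^T (dlsubmx M) (drsubmx M) /\
  (drsubmx M)^T = drsubmx M.
Proof.
move=> sM; have := sM; rewrite -[in LHS](submxK M) tr_block_mx -[in RHS](submxK M).
move=> /eq_block_mx [_ _ e1 e2]; split=> //.
rewrite -[LHS]submxK; congr block_mx; first exact: mx11_scalar.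
by rewrite -e1 trmxK.
Qed.

Lemma rsqrtK (a : R) : 0 < a -> (Num.sqrt a)^-1 ^+ 2 * a = 1.
Proof. by move=> a0; rewrite exprVn sqr_sqrtr ?ltW// mulVf// gt_eqF. Qed.

(** The quadratic form of the Schur complement at [w] is that of [M] at the vector
    [(- a^-1 b^T w, w)], which minimizes it over the first coordinate. *)
Lemma posdef_schur n (M : 'M[R]_(1 + n)) : posdef M ->
  posdef (drsubmx M - (Num.sqrt (ulsubmx M 0 0))^-1 ^+ 2 *:
            (dlsubmx M *m (dlsubmx M)^T)).
Proof.
move=> pM; have a0 := posdef_corner pM; have ra := rsqrtK a0.
have [sM pMw] := pM; have [ME sD] := sym_block sM.
set a := ulsubmx M 0 0 in a0 ra ME *; set r := (Num.sqrt a)^-1 in ra *.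
set b := dlsubmx M in ME *; set D := drsubmx M in sD ME *.
split=> [|w w0].
  by rewrite linearB/= linearZ/= trmx_mul trmxK sD.
pose t := (b^T *m w) 0 0.
have tE : b^T *m w = t%:M by rewrite [LHS]mx11_scalar.
have tE' : w^T *m b = t%:M by rewrite -[LHS]trmxK trmx_mul trmxK tE tr_scalar_mx.
have /pMw : col_mx (- (r ^+ 2 * t))%:M w != 0.
  apply: contra w0 => /eqP e; apply/eqP; have : dsubmx (col_mx (- (r ^+ 2 * t))%:M w) = 0.
    by rewrite e linear0.
  by rewrite col_mxKd.
have -> : w^T *m (D - r ^+ 2 *: (b *m b^T)) *m w = w^T *m D *m w - (r ^+ 2 * (t * t))%:M.
  rewrite mulmxBr mulmxBl -scalemxAr -scalemxAl; congr (_ - _).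
  by rewrite -!mulmxA tE !mulmxA tE' -scalar_mxM scale_scalar_mx.
rewrite ME tr_col_mx mul_row_block mul_row_col tr_scalar_mx.
rewrite !mulmxDl tE' -[_%:M *m b^T *m w]mulmxA tE -!scalar_mxM.
rewrite !mxE /= !mulr1n; set z := \sum_j _.
suff -> : - (r ^+ 2 * t) * a * - (r ^+ 2 * t) + t * - (r ^+ 2 * t) +
   (- (r ^+ 2 * t) * t + z) = z - r ^+ 2 * (t * t) by move=> ->.
have -> : - (r ^+ 2 * t) * a * - (r ^+ 2 * t) = (r ^+ 2 * a) * (r ^+ 2 * (t * t)).
  by ring.
by rewrite ra; ring.
Qed.

Lemma inv_choleskyP n (M : 'M[R]_n) : posdef M ->
  inv_cholesky M *m M *m (inv_cholesky M)^T = 1%:M.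
Proof.
elim: n M => [|n IH] M pM; first by apply/matrixP => -[].
have a0 := posdef_corner pM; have ra := rsqrtK a0.
have [sM pMw] := pM; have [ME sD] := sym_block sM.
have := IH _ (posdef_schur pM); rewrite /=.
set a := @ulsubmx R 1 n 1 n M 0 0 in a0 ra ME *; set r := (Num.sqrt a)^-1 in ra *.
set b := @dlsubmx R 1 n 1 n M in ME *; set D := @drsubmx R 1 n 1 n M in sD ME *.
set U := inv_cholesky _ => US.
rewrite ME (@mulmx_block R 1 n 1 n 1 n) (@tr_block_mx R 1 n 1 n) (@mulmx_block R 1 n 1 n 1 n).
rewrite !mul0mx !addr0 !trmx0 !mulmx0 !addr0 tr_scalar_mx.
have e0 : - (r ^+ 2 *: (U *m b)) *m a%:M + U *m b = 0.
  by rewrite mul_mx_scalar scalerN scalerA mulrC ra scale1r addNr.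
rewrite e0 !mul0mx add0r.
have -> : - (r ^+ 2 *: (U *m b)) *m b^T + U *m D =
   U *m (D - r ^+ 2 *: (b *m b^T)).
  by rewrite mulmxBr mulNmx -scalemxAl -scalemxAr mulmxA addrC.
rewrite US -!scalar_mxM (_ : r * a * r = 1); last by rewrite -ra; ring.
have -> : (r * a)%:M *m (- (r ^+ 2 *: (U *m b)))^T + r%:M *m b^T *m U^T = 0.
  rewrite linearN/= linearZ/= trmx_mul mulmxN mul_scalar_mx scalerA.
  rewrite -mulmxA mul_scalar_mx (_ : r * a * r ^+ 2 = r) ?addNr//.
  by rewrite -[RHS]mulr1 -ra; ring.
by rewrite -scalar_mx_block.
Qed.

Lemma inv_cholesky1 n : inv_cholesky (1%:M : 'M[R]_n) = 1%:M.
Proof.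
elim: n => [//|n IH] /=.
have -> : (1%:M : 'M[R]_n.+1) = block_mx (1%:M : 'M[R]_1) 0 0 1%:M by rewrite -scalar_mx_block.
rewrite block_mxKul block_mxKdl block_mxKdr mul0mx scaler0 subr0 IH mulmx0 scaler0.
by rewrite oppr0 mxE/= sqrtr1 invr1.
Qed.

(** A grading [d] of the coordinates respected by [M] is respected by the Schur
    complement: the entry [(i, j)] of [b b^T] vanishes unless [i] and [j] both have
    the degree of the first coordinate. For the grading by the eigenspaces of a
    diagonal matrix, respecting it means commuting with that matrix. *)
Lemma inv_cholesky_graded n (T : eqType) (d : 'I_n -> T) (M : 'M[R]_n) : M^T = M ->
  (forall i j, d i != d j -> M i j = 0) ->
  forall i j, d i != d j -> inv_cholesky M i j = 0.
Proof.
elim: n d M => [|n IH] d M sM dM i j; first by case: i.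
have [_ sD] := sym_block sM.
rewrite /=; set a := @ulsubmx R 1 n 1 n M 0 0; set r := (Num.sqrt a)^-1.
set b := @dlsubmx R 1 n 1 n M; set D := @drsubmx R 1 n 1 n M in sD *.
have b0 k : d (rshift 1 k) != d (@lshift 1 n 0) -> b k 0 = 0.
  by move=> dk; rewrite !mxE; exact: dM.
set S := D - _; set U := inv_cholesky _.
have U0 : forall k l, d (rshift 1 k) != d (rshift 1 l) -> U k l = 0.
  apply: (IH (fun k => d (rshift 1 k))).
    by rewrite linearB/= linearZ/= trmx_mul trmxK sD.
  move=> k l dkl; rewrite !mxE big_ord1 [X in X - _]dM// sub0r !mxE.
  have [/eqP e|/dM ->] := boolP (d (rshift 1 k) == d (@lshift 1 n 0)); last first.
    by rewrite mul0r mulr0 oppr0.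
  rewrite [X in _ * (_ * X)](_ : _ = 0) ?mulr0 ?oppr0//.
  by apply/dM; rewrite eq_sym -e.
have [i' ->|i' ->] := @split_ordP 1 n i; have [j' ->|j' ->] := @split_ordP 1 n j.
- by rewrite !ord1 eqxx.
- by move=> _; rewrite (@block_mxEur R 1 n 1 n) mxE.
- move=> dij; rewrite (@block_mxEdl R 1 n 1 n) !mxE big1 ?mulr0 ?oppr0// => k _.
  have [/eqP e|/U0 ->] := boolP (d (rshift 1 i') == d (rshift 1 k)); last by rewrite mul0r.
  by rewrite !ord1 b0 ?mulr0// -e -(ord1 j').
- by move=> dij; rewrite (@block_mxEdr R 1 n 1 n); exact: U0.
Qed.

Lemma smooth_inv_cholesky (V : normedModType R) (x : V) n (M : V -> 'M[R]_n) :
  smooth_mx_at x M -> posdef (M x) -> smooth_mx_at x (fun y => inv_cholesky (M y)).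
Proof.
elim: n M => [|n IH] M sM pM; first by move=> [].
rewrite /=.
have a0 := posdef_corner pM.
have sa : smooth_at x (fun y => @ulsubmx R 1 n 1 n (M y) 0 0).
  by under [X in smooth_at _ X]eq_fun do rewrite !mxE; exact: sM.
have sr : smooth_at x (fun y => (Num.sqrt (@ulsubmx R 1 n 1 n (M y) 0 0))^-1).
  exact: smooth_at_rsqrt.
have sr2 : smooth_at x (fun y => (Num.sqrt (@ulsubmx R 1 n 1 n (M y) 0 0))^-1 ^+ 2).
  by under [X in smooth_at _ X]eq_fun do rewrite expr2; exact: smooth_atM.
have sb : smooth_mx_at x (fun y => @dlsubmx R 1 n 1 n (M y)).
  by move=> i j; under [X in smooth_at _ X]eq_fun do rewrite !mxE; exact: sM.
have sD : smooth_mx_at x (fun y => @drsubmx R 1 n 1 n (M y)).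
  by move=> i j; under [X in smooth_at _ X]eq_fun do rewrite !mxE; exact: sM.
have sU : smooth_mx_at x (fun y => inv_cholesky
   (@drsubmx R 1 n 1 n (M y) - (Num.sqrt (@ulsubmx R 1 n 1 n (M y) 0 0))^-1 ^+ 2 *:
   (@dlsubmx R 1 n 1 n (M y) *m (@dlsubmx R 1 n 1 n (M y))^T))).
  apply: IH (posdef_schur pM); apply: smooth_mxD => //; apply: smooth_mxN; apply: smooth_mxZ => //.
  by apply: smooth_mxM => //; exact: smooth_mxT.
apply: (@smooth_mx_block R V x 1 n 1 n) => //.
- move=> i j; rewrite (ord1 i) (ord1 j).
  by under [X in smooth_at _ X]eq_fun do rewrite mxE eqxx mulr1n.
- exact: smooth_mx_cst.
- apply: smooth_mxN; apply: smooth_mxZ => //; exact: smooth_mxM.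
Qed.

End Cholesky.

(** * Singular values *)

Section SVD.
Variable R : realType.

Lemma dotmxE n (u v : 'cV[R]_n) : (u^T *m v) 0 0 = \sum_i u i 0 * v i 0.
Proof. by rewrite mxE; apply: eq_bigr => i _; rewrite mxE. Qed.

Lemma dot_ge0 n (u : 'cV[R]_n) : 0 <= (u^T *m u) 0 0.
Proof. by rewrite dotmxE sumr_ge0// => i _; rewrite -expr2 sqr_ge0. Qed.

Lemma dot_eq0 n (u : 'cV[R]_n) : ((u^T *m u) 0 0 == 0) = (u == 0).
Proof.
apply/idP/eqP => [|->]; last by rewrite mulmx0 mxE.
rewrite dotmxE psumr_eq0 => [/allP/= u0|i _]; last by rewrite -expr2 sqr_ge0.
apply/matrixP => i j; rewrite (ord1 j) mxE.
by have := u0 i; rewrite mem_index_enum -expr2 sqrf_eq0 => /(_ isT)/eqP.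
Qed.

Lemma normalize n (u : 'cV[R]_n) : u != 0 ->
  exists2 r : R, 0 < r & (r *: u)^T *m (r *: u) = 1%:M.
Proof.
move=> u0; have d0 : 0 < (u^T *m u) 0 0 by rewrite lt_def dot_eq0 u0 dot_ge0.
exists (Num.sqrt ((u^T *m u) 0 0))^-1; first by rewrite invr_gt0 sqrtr_gt0.
rewrite [(_ *: _)^T]linearZ/= -scalemxAl -scalemxAr scalerA -expr2 [X in _ *: X]mx11_scalar.
by rewrite scale_scalar_mx exprVn sqr_sqrtr ?ltW// mulVf// gt_eqF.
Qed.

(** The real and imaginary parts of an eigenvector for the complex eigenvalue
    [a + i b]. *)
Lemma complex_eigenvector n (S : 'M[R]_n.+1) : exists (a b : R) (x y : 'cV[R]_n.+1),
  [/\ S *m x = a *: x - b *: y, S *m y = b *: x + a *: y & (x != 0) || (y != 0)].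
Proof.
pose Sc := map_mx (real_complex R) S^T.
have /closed_rootP [z] : size (char_poly Sc) != 1 by rewrite size_char_poly.
rewrite -eigenvalue_root_char => /eigenvalueP [v vS v0].
case: z vS => a b vS.
pose x := (map_mx (@complex.Re R) v)^T; pose y := (map_mx (@complex.Im R) v)^T.
have key i : (S *m x) i 0 = a * x i 0 - b * y i 0 /\
             (S *m y) i 0 = b * x i 0 + a * y i 0.
  have := congr1 (fun w : 'rV_n.+1 => w 0 i) vS; rewrite !mxE => e.
  have := congr1 (@complex.Re R) e; have := congr1 (@complex.Im R) e; rewrite !raddf_sum /= => e1 e2.
  have -> : \sum_j S i j * x j 0 = \sum_j (fun j => complex.Re (v 0 j * Sc j i)) j.
    by apply: eq_bigr => j _; rewrite !mxE; case: (v 0 j) => ? ? /=; ring.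
  have -> : \sum_j S i j * y j 0 = \sum_j (fun j => complex.Im (v 0 j * Sc j i)) j.
    by apply: eq_bigr => j _; rewrite !mxE; case: (v 0 j) => ? ? /=; ring.
  rewrite e1 e2; case: (v 0 i) => ? ? /=; split; ring.
exists a, b, x, y; split.
- by apply/matrixP => i j; rewrite (ord1 j) (key i).1 !mxE.
- by apply/matrixP => i j; rewrite (ord1 j) (key i).2 !mxE.
apply: contra_neqT v0; rewrite negb_or !negbK => /andP[/eqP x0 /eqP y0].
apply/matrixP => i j; rewrite (ord1 i) mxE.
have := congr1 (fun w : 'cV_n.+1 => w j 0) x0.
have := congr1 (fun w : 'cV_n.+1 => w j 0) y0.
by rewrite !mxE; case: (v 0 j) => ? ? /= -> ->.
Qed.

(** With [x], [y] as in [complex_eigenvector], comparing [x^T S y] with [y^T S x]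
    gives [b (x^T x + y^T y) = 0]. *)
Lemma symmetric_eigenvector n (S : 'M[R]_n.+1) : S^T = S ->
  exists (a : R) (k : 'cV[R]_n.+1), k^T *m k = 1%:M /\ S *m k = a *: k.
Proof.
move=> sS; have [a [b [x [y [Sx Sy xy0]]]]] := complex_eigenvector S.
have b0 : b = 0.
  have e : x^T *m (S *m y) = (y^T *m (S *m x))^T.
    by rewrite !trmx_mul trmxK sS mulmxA.
  move: e; rewrite Sx Sy mulmxDr mulmxBr -!scalemxAr.
  rewrite [(_ - _)^T]linearB/= ![(_ *: _)^T]linearZ/= !trmx_mul !trmxK.
  move=> /(congr1 (fun w : 'M[R]_1 => w 0 0)) e.
  have {}e : b * ((x^T *m x) 0 0 + (y^T *m y) 0 0) = 0.
    by move: e; rewrite !mxE; lra.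
  move/eqP : e; rewrite mulf_eq0 => /orP[/eqP//|].
  rewrite paddr_eq0 ?dot_ge0// !dot_eq0 => /andP[/eqP x0 /eqP y0].
  by move: xy0; rewrite x0 y0 eqxx.
rewrite b0 !scale0r ?subr0 ?add0r in Sx Sy.
have [z [z0 Sz]] : exists z : 'cV[R]_n.+1, z != 0 /\ S *m z = a *: z.
  by case/orP: xy0 => ?; [exists x|exists y].
have [r _ rz] := normalize z0.
by exists a, (r *: z); split=> //; rewrite -scalemxAr Sz !scalerA mulrC.
Qed.

(** The vector [k] is an eigenvector of [M M^T], and [l] is [M^T k] normalized;
    if [M^T k = 0], then [M] is singular and [l] is taken in its kernel. *)
Lemma singular_pair n (M : 'M[R]_n.+1) : exists (k l : 'cV[R]_n.+1) (mu nu : R),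
  [/\ k^T *m k = 1%:M, l^T *m l = 1%:M, M *m l = mu *: k & M^T *m k = nu *: l].
Proof.
have [a [k [kk Sk]]] : exists (a : R) (k : 'cV[R]_n.+1),
    k^T *m k = 1%:M /\ (M *m M^T) *m k = a *: k.
  by apply: symmetric_eigenvector; rewrite trmx_mul trmxK.
have [Mk0|Mk0] := eqVneq (M^T *m k) 0.
  have /det0P [v v0 vM] : \det M^T == 0.
    rewrite det_tr; apply/det0P; exists k^T.
      by apply: contraTneq isT => k0; move/matrixP/(_ 0 0)/eqP: kk; rewrite k0 mul0mx !mxE /= eq_sym oner_eq0.
    by rewrite -[LHS]trmxK trmx_mul trmxK Mk0 trmx0.
  have vT0 : v^T != 0 by rewrite trmx_eq0.
  have [r _ rv] := normalize vT0.
  exists k, (r *: v^T), 0, 0; split=> //; last by rewrite Mk0 scale0r.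
  by rewrite scale0r -scalemxAr -[M *m _]trmxK trmx_mul trmxK vM trmx0 scaler0.
have [r r0 rl] := normalize Mk0.
exists k, (r *: (M^T *m k)), (r * a), r^-1; split=> //.
  by rewrite -scalemxAr mulmxA Sk scalerA.
by rewrite scalerA mulVf ?scale1r// gt_eqF.
Qed.

(** The reflection in the hyperplane orthogonal to [u - e], where [e] is the first
    basis vector, or the identity if [u = e]. *)
Lemma householder n (u : 'cV[R]_(1 + n)) : u^T *m u = 1%:M ->
  exists H : 'M[R]_(1 + n), [/\ H^T = H, H *m H = 1%:M & H *m col_mx 1%:M 0 = u].
Proof.
move=> uu; set e : 'cV_(1 + n) := col_mx 1%:M 0.
have ee : e^T *m e = 1%:M.
  by rewrite tr_col_mx mul_row_col trmx0 mul0mx addr0 trmx1 mulmx1.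
have [ue|ue] := eqVneq u e.
  by exists 1%:M; rewrite trmx1 !mul1mx.
pose w := u - e; have w0 : w != 0 by rewrite subr_eq0.
pose c := (w^T *m w) 0 0; have c0 : c != 0 by rewrite dot_eq0.
pose t := (u^T *m e) 0 0.
have ueE : u^T *m e = t%:M by rewrite [LHS]mx11_scalar.
have euE : e^T *m u = t%:M by rewrite -[LHS]trmxK trmx_mul trmxK ueE tr_scalar_mx.
have wwE : w^T *m w = c%:M by rewrite [LHS]mx11_scalar.
have cE : c = 2 - 2 * t.
  rewrite /c /w [(_ - _)^T]linearB/= mulmxBl !mulmxBr uu ee ueE euE !mxE /=; ring.
pose H : 'M[R]_(1 + n) := 1%:M - (2 / c) *: (w *m w^T).
exists H; split.
- by rewrite linearB/= linearZ/= trmx_mul trmxK trmx1.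
- rewrite mulmxBl mul1mx mulmxBr mulmx1 -scalemxAl -!scalemxAr.
  rewrite -[w *m w^T *m _]mulmxA [w^T *m (_ *m _)]mulmxA wwE mul_scalar_mx -scalemxAr.
  rewrite !scalerA (_ : 2 / c * (2 / c * c) = 2 / c + 2 / c); last by field.
  by rewrite scalerDl opprB addrK subrK.
- rewrite mulmxBl mul1mx -scalemxAl -mulmxA.
  have -> : w^T *m e = (- (c / 2))%:M.
    rewrite [(_ - _)^T]linearB/= mulmxBl ueE ee; apply/matrixP => i j.
    by rewrite (ord1 i) (ord1 j) !mxE /= !mulr1n cE; field.
  rewrite mul_mx_scalar scalerA mulrN (_ : 2 / c * (c / 2) = 1); last by field.
  by rewrite scaleN1r opprK addrC subrK.
Qed.

(** Householder reflections moving the two vectors of a [singular_pair] to the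
    first basis vector split off a block of size one. *)
Lemma svd n (M : 'M[R]_n) : exists (K L : 'M[R]_n) (c : 'rV[R]_n),
  [/\ K^T *m K = 1%:M, L^T *m L = 1%:M & K^T *m M *m L = diag_mx c].
Proof.
elim: n M => [|n IH] M.
  by exists 1%:M, 1%:M, 0; split; apply/matrixP => -[].
have [k [l [mu [nu [kk ll Ml Mk]]]]] := singular_pair M.
have [H [sH HH He]] := @householder n k kk.
have [G [sG GG Ge]] := @householder n l ll.
pose N : 'M[R]_(1 + n) := H *m M *m G.
have Ne : N *m col_mx 1%:M 0 = mu *: col_mx 1%:M 0.
  by rewrite -mulmxA Ge -mulmxA Ml -scalemxAr -He mulmxA HH mul1mx.
have Nte : N^T *m col_mx 1%:M 0 = nu *: col_mx 1%:M 0.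
  rewrite !trmx_mul sH sG -!mulmxA [H *m col_mx _ _]He Mk -scalemxAr.
  by rewrite -Ge mulmxA GG mul1mx.
have NE : N = block_mx mu%:M 0 0 (drsubmx N).
  move: Ne Nte; rewrite -[N in N *m _]submxK -[N in N^T]submxK tr_block_mx.
  rewrite !mul_block_col !mulmx0 !addr0 !mulmx1 !scale_col_mx scaler0.
  move=> /eq_col_mx [e1 e2] /eq_col_mx [_ e3].
  rewrite -[LHS]submxK e1 e2 scalemx1; congr block_mx.
  by rewrite -[LHS]trmxK e3 scaler0 trmx0.
have [K' [L' [c [KK LL KML]]]] := IH (drsubmx N).
pose K1 : 'M[R]_(1 + n) := block_mx 1%:M 0 0 K'.
pose L1 : 'M[R]_(1 + n) := block_mx 1%:M 0 0 L'.
have K1K : K1^T *m K1 = 1%:M.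
  by rewrite tr_block_mx mulmx_block !trmx0 !mul0mx !mulmx0 !addr0 !add0r trmx1 mulmx1 KK -scalar_mx_block.
have L1L : L1^T *m L1 = 1%:M.
  by rewrite tr_block_mx mulmx_block !trmx0 !mul0mx !mulmx0 !addr0 !add0r trmx1 mulmx1 LL -scalar_mx_block.
have KNL : K1^T *m N *m L1 = diag_mx (row_mx mu%:M c).
  rewrite NE tr_block_mx !mulmx_block !trmx0 !mul0mx !mulmx0 !addr0 !add0r trmx1.
  rewrite !mulmx1 !mul1mx KML ?mul0mx ?mulmx0 diag_mx_row.
  congr block_mx; apply/matrixP => i j; rewrite !mxE.
  by rewrite (ord1 i) (ord1 j) eqxx.
exists (H *m K1), (G *m L1), (row_mx mu%:M c); split.
- by rewrite trmx_mul sH mulmxA -(mulmxA _ H H) HH mulmx1.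
- by rewrite trmx_mul sG mulmxA -(mulmxA _ G G) GG mulmx1.
- by rewrite -KNL trmx_mul sH /N !mulmxA.
Qed.

End SVD.

(** * Symmetric involutions and the orbit of the identity *)

Lemma orth_det (R : realType) n (A : 'M[R]_n) : A *m A^T = 1%:M -> \det A = 1 \/ \det A = -1.
Proof.
move=> /(congr1 determinant); rewrite det_mulmx det_tr det1 -expr2 => /eqP.
by rewrite sqrf_eq1 => /orP[] /eqP; [left|right].
Qed.

Section Orbit.
Variables (R : realType) (p q : nat).
Local Notation n := (p + q)%N.
Local Notation J := (Jpq R p q).
Local Notation G := (SE R n).
Implicit Types (A B C : 'M[R]_n) (g h s : G).

Definition Jsign : 'rV[R]_n := row_mx (const_mx (-1)) (const_mx 1).

Lemma JpqE : J = diag_mx Jsign.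
Proof.
rewrite diag_mx_row /Jpq; congr block_mx; last by rewrite diag_const_mx.
by rewrite diag_const_mx raddfN.
Qed.

Lemma JsignE (i : 'I_n) : Jsign 0 i = if (i < p)%N then -1 else 1.
Proof.
have [i' ->|i' ->] := split_ordP i; rewrite ?row_mxEl ?row_mxEr mxE.
  by rewrite /= ?ltn_ord.
by rewrite /= ?ltnNge ?leq_addr.
Qed.

Lemma commute_J_graded A : A *m J = J *m A <-> forall i j : 'I_n,
  (i < p)%N != (j < p)%N -> A i j = 0.
Proof.
rewrite JpqE; split=> [/matrixP e i j dij|A0].
  have := e i j; rewrite mul_diag_mx mul_mx_diag mxE [RHS]mxE !JsignE.
  by case: ifP dij; case: ifP => //= _ _ _; lra.
apply/matrixP => i j; rewrite mul_diag_mx mul_mx_diag mxE [RHS]mxE !JsignE mulrC.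
have [->//|/A0 ->] := eqVneq (i < p)%N (j < p)%N.
by rewrite !mulr0.
Qed.

Lemma inv_cholesky_J (M : 'M[R]_n) : M^T = M -> M *m J = J *m M ->
  inv_cholesky M *m J = J *m inv_cholesky M.
Proof.
move=> sM /commute_J_graded cM; apply/commute_J_graded.
exact: (@inv_cholesky_graded R n _ (fun i : 'I_n => (i < p)%N)).
Qed.

Lemma gram_posdef C : C \in unitmx -> posdef (C^T *m C).
Proof.
move=> uC; split=> [|w w0]; first by rewrite trmx_mul trmxK.
have Cw : C *m w != 0.
  by apply: contra w0 => /eqP e; rewrite -[w](mulKmx uC) e mulmx0.
rewrite mulmxA -trmx_mul -mulmxA.
by rewrite lt_def dot_eq0 Cw dot_ge0.
Qed.

Definition orthonormalize C := C *m (inv_cholesky (C^T *m C))^T.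

Lemma orthonormalize_orth C : C \in unitmx ->
  orthonormalize C *m (orthonormalize C)^T = 1%:M.
Proof.
move=> uC; apply: mulmx1C; rewrite trmx_mul trmxK !mulmxA.
by rewrite -(mulmxA _ C^T C) inv_choleskyP//; exact: gram_posdef.
Qed.

(** The relations give [C^T C J = C^T B C = (B C)^T C = J C^T C]. *)
Lemma orthonormalize_intertwine B C : C \in unitmx -> B^T = B -> B *m C = C *m J ->
  B *m orthonormalize C = orthonormalize C *m J.
Proof.
move=> uC sB BC; have [sM _] := gram_posdef uC.
have /(congr1 trmx) : inv_cholesky (C^T *m C) *m J = J *m inv_cholesky (C^T *m C).
  apply: inv_cholesky_J => //.
  by rewrite -mulmxA -BC !mulmxA -{1}sB -trmx_mul BC trmx_mul tr_Jpq.
rewrite !trmx_mul tr_Jpq => e.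
by rewrite /orthonormalize mulmxA BC -!mulmxA e.
Qed.

Lemma orthonormalize1 : orthonormalize 1%:M = 1%:M.
Proof. by rewrite /orthonormalize trmx1 !mul1mx inv_cholesky1 trmx1. Qed.

Hypothesis p_gt0 : (0 < p)%N.

(** An orthonormalized [C] of determinant [-1] is corrected by the reflection of
    the first coordinate, which commutes with [J] and exists as [0 < p]. *)
Lemma orbit_of_intertwiner B C : B^T = B -> C \in unitmx -> B *m C = C *m J ->
  exists2 A, SO_set A & B = A *m J *m A^T.
Proof.
move=> sB uC BC; have oA := orthonormalize_orth uC.
have BA := orthonormalize_intertwine uC sB BC.
set A := orthonormalize C in oA BA.
have BE : B = A *m J *m A^T by rewrite -BA -mulmxA oA mulmx1.
have [dA|dA] := orth_det oA; first by exists A.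
(* [diag_mx d] is the reflection of the first coordinate. *)
pose i0 : 'I_n := lshift q (Ordinal p_gt0).
pose d : 'rV[R]_n := \row_j if j == i0 then -1 else 1.
have dd : diag_mx d *m diag_mx d = 1%:M.
  rewrite mulmx_diag -diag_const_mx; congr diag_mx.
  by apply/matrixP => i j; rewrite !mxE; case: ifP; rewrite ?mulr1// mulrNN mulr1.
have dJ : diag_mx d *m J = J *m diag_mx d.
  by rewrite JpqE !mulmx_diag; congr diag_mx; apply/matrixP => i j; rewrite !mxE mulrC.
exists (A *m diag_mx d); first split.
- by rewrite trmx_mul tr_diag_mx mulmxA -(mulmxA A) dd mulmx1.
- rewrite det_mulmx dA det_diag (bigD1 i0)//= big1 ?mxE ?eqxx ?mulr1 ?mulrNN ?mulr1//.
  by move=> i /negPf i0i; rewrite mxE i0i.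
- by rewrite trmx_mul tr_diag_mx -!mulmxA (mulmxA J) -dJ !mulmxA -(mulmxA A (diag_mx d) (diag_mx d)) dd mulmx1.
Qed.

Lemma SE_rotM g h : SE_rot (g * h)%g = SE_rot g *m SE_rot h. Proof. by []. Qed.
Lemma SE_transM g h : SE_trans (g * h)%g = SE_trans g + SE_rot g *m SE_trans h.
Proof. by []. Qed.
Lemma SE_rotV g : SE_rot g^-1%g = (SE_rot g)^T. Proof. by []. Qed.
Lemma SE_transV g : SE_trans g^-1%g = - ((SE_rot g)^T *m SE_trans g). Proof. by []. Qed.
Lemma SE_rot_sigma g : SE_rot (sigma g) = J *m SE_rot g *m J. Proof. by []. Qed.
Lemma SE_trans_sigma g : SE_trans (sigma g) = J *m SE_trans g. Proof. by []. Qed.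
Lemma SE_rot1 : SE_rot (1%g : G) = 1%:M. Proof. by []. Qed.
Lemma SE_trans1 : SE_trans (1%g : G) = 0. Proof. by []. Qed.
Lemma SE_rotK g : SE_rot g *m (SE_rot g)^T = 1%:M. Proof. by case: (rot_SO g). Qed.
Lemma SE_rotTK g : (SE_rot g)^T *m SE_rot g = 1%:M. Proof. exact/mulmx1C/SE_rotK. Qed.

Lemma twistedM g h s : twisted (g * h)%g s = twisted g (twisted h s).
Proof. by rewrite /twisted invgM sigmaM !mulgA. Qed.

Lemma twisted1 s : twisted 1%g s = s.
Proof. by rewrite /twisted invg1 sigma1 mul1g mulg1. Qed.

Lemma SE_rot_twisted g h : SE_rot (twisted g h) =
  SE_rot g *m SE_rot h *m J *m (SE_rot g)^T *m J.
Proof. by rewrite /twisted !SE_rotM SE_rot_sigma SE_rotV !mulmxA. Qed.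

Lemma SE_trans_twisted g h : SE_trans (twisted g h) =
  SE_trans g + SE_rot g *m SE_trans h -
  SE_rot g *m SE_rot h *m J *m (SE_rot g)^T *m SE_trans g.
Proof.
by rewrite /twisted !SE_transM SE_trans_sigma SE_transV !mulmxN !SE_rotM !mulmxA.
Qed.

Lemma Sp_twisted g s : Sp R p q s -> Sp R p q (twisted g s).
Proof. by move=> [h _ <-]; exists (g * h)%g => //; rewrite twistedM. Qed.

(** For [g] in Q this is a symmetric involution: it is the orthogonal reflection
    whose fixed space is the point of the Grassmannian defined by [g]. *)
Definition reflection g := SE_rot g *m J.

Lemma QsetP g : Qset R p q g <->
  (reflection g)^T = reflection g /\ reflection g *m SE_trans g = - SE_trans g.
Proof.
rewrite /reflection trmx_mul tr_Jpq; split => [Qg|[e1 e2]].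
  have /(congr1 (@SE_rot _ _)) := Qg; rewrite SE_rot_sigma SE_rotV => e1.
  have /(congr1 (@SE_trans _ _)) := Qg; rewrite SE_trans_sigma SE_transV => e2.
  split; first by rewrite -e1 !mulmxA JpqK mul1mx.
  by rewrite -mulmxA e2 mulmxN mulmxA SE_rotK mul1mx.
rewrite /Qset /=; apply: SE_eq.
  rewrite SE_rot_sigma SE_rotV -[RHS]mul1mx -JpqK -!mulmxA -e1.
  by rewrite !mulmxA.
rewrite SE_trans_sigma SE_transV -[LHS]mul1mx -(SE_rotTK g) -mulmxN -e2.
by rewrite !mulmxA.
Qed.

Lemma reflectionK g : Qset R p q g -> reflection g *m reflection g = 1%:M.
Proof.
move=> /QsetP [e _]; rewrite -[X in X *m _]e /reflection trmx_mul tr_Jpq.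
by rewrite -mulmxA (mulmxA _ _ J) SE_rotTK mul1mx JpqK.
Qed.

(** The preimage of [(R, Y)] is [(A, Y / 2)], since [B Y = - Y]. *)
Lemma SpP g : Sp R p q g <->
  Qset R p q g /\ exists2 A, SO_set A & reflection g = A *m J *m A^T.
Proof.
split=> [[h _ <-]|[/QsetP [e1 e2] [A sA gA]]].
  have rE : reflection (twisted h 1%g) = SE_rot h *m J *m (SE_rot h)^T.
    by rewrite /reflection SE_rot_twisted SE_rot1 mulmx1 -mulmxA JpqK mulmx1.
  split; last by exists (SE_rot h); [exact: rot_SO|].
  apply/QsetP; rewrite rE; split; first by rewrite !trmx_mul trmxK tr_Jpq mulmxA.
  rewrite SE_trans_twisted SE_trans1 SE_rot1 mulmx0 addr0 mulmx1 mulmxBr !mulmxA.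
  rewrite -(mulmxA _ (SE_rot h)^T (SE_rot h)) SE_rotTK mulmx1.
  by rewrite -(mulmxA _ J J) JpqK mulmx1 SE_rotK mul1mx opprB.
exists (mkSE (2^-1 *: SE_trans g) sA) => //; apply: SE_eq.
  rewrite SE_rot_twisted SE_rot1 mulmx1 -[SE_rot (mkSE _ _)]/A -gA.
  by rewrite /reflection -mulmxA JpqK mulmx1.
rewrite SE_trans_twisted SE_rot1 mulmx1 SE_trans1 mulmx0 addr0.
rewrite -[SE_rot (mkSE _ _)]/A -[SE_trans (mkSE _ _)]/(2^-1 *: SE_trans g) -gA.
rewrite -scalemxAr e2 scalerN opprK -scalerDl.
by rewrite [X in X *: _](_ : _ = 1) ?scale1r//; field.
Qed.

Lemma Sp_Qset g : Sp R p q g -> Qset R p q g.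
Proof. by move=> /SpP []. Qed.

(** The matrix [1 + B B'] intertwines the involutions [B'] and [B], because both
    [B (1 + B B')] and [(1 + B B') B'] are [B + B']. *)
Lemma Sp_of_close g h : Qset R p q g -> Sp R p q h ->
  \det (1%:M + reflection g *m reflection h) != 0 -> Sp R p q g.
Proof.
move=> Qg /SpP [Qh [A sA hA]] d0; apply/SpP; split=> //.
have [sg _] := (QsetP g).1 Qg.
have uA : A \in unitmx by rewrite unitmxE; case: sA => _ ->; exact: unitr1.
apply: (@orbit_of_intertwiner _ ((1%:M + reflection g *m reflection h) *m A)) => //.
  by rewrite unitmx_mul uA andbT unitmxE unitfE.
rewrite mulmxA mulmxDr mulmx1 (mulmxA _ (reflection g)) (reflectionK Qg) mul1mx.
have [oA _] := sA; have hAJ : A *m J = reflection h *m A.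
  by rewrite hA -(mulmxA _ A^T) (mulmx1C oA) mulmx1.
rewrite -[RHS]mulmxA hAJ [RHS]mulmxA; congr (_ *m A).
rewrite mulmxDl mul1mx -(mulmxA (reflection g) (reflection h) (reflection h)).
by rewrite (reflectionK Qh) mulmx1 addrC.
Qed.

End Orbit.

(** * Rotations in pairwise orthogonal planes *)

Section Planar.
Variables (R : realType) (n : nat) (I : finType) (P : pred I) (E : I -> 'M[R]_n).

(** Each [E i] is modelled on the generator of the rotations of a plane, with
    [E i ^ 2] equal to minus the orthogonal projection onto the plane; the planes
    are pairwise orthogonal. *)
Definition planar :=
  (forall i j, P i -> P j -> i != j -> E i *m E j = 0) /\
  (forall i, P i -> E i *m E i *m E i = - E i).

(** It acts on the plane of [E i] as the complex number [b i + i a i], where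
    [E i] plays the role of the imaginary unit, and on the orthogonal complement
    of all the planes as the scalar [d]. *)
Definition planar_mx (d : R) (b a : I -> R) : 'M[R]_n :=
  d%:M + \sum_(i | P i) (a i *: E i + (d - b i) *: (E i *m E i)).

Lemma eq_planar_mx d b b' a a' : (forall i, P i -> b i = b' i) ->
  (forall i, P i -> a i = a' i) -> planar_mx d b a = planar_mx d b' a'.
Proof.
by move=> eb ea; congr (_ + _); apply: eq_bigr => i Pi; rewrite eb// ea.
Qed.

Lemma planar_mx1 : planar_mx 1 (fun=> 1) (fun=> 0) = 1%:M.
Proof.
rewrite /planar_mx big1 ?addr0// => i _.
by rewrite scale0r subrr scale0r addr0.
Qed.

Hypothesis plE : planar.

Lemma planar_mxM d b a d' b' a' :
  planar_mx d b a *m planar_mx d' b' a' =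
  planar_mx (d * d') (fun i => b i * b' i - a i * a' i)
                     (fun i => a i * b' i + b i * a' i).
Proof.
have [E0 E3] := plE.
rewrite /planar_mx mulmxDl mul_scalar_mx scalerDr scale_scalar_mx.
rewrite mulmxDr mul_mx_scalar -addrA; congr (_ + _).
rewrite mulmx_suml; under [X in _ + (_ + X)]eq_bigr => i Pi.
  rewrite mulmx_sumr (bigD1 i)//= big1 ?addr0; last first.
    move=> j /andP[Pj ji].
    have E0ij := E0 i j Pi Pj; rewrite eq_sym in ji.
    rewrite mulmxDl !mulmxDr -!scalemxAl -!scalemxAr !mulmxA.
    rewrite -(mulmxA (E i) (E i) (E j)) E0ij// !(mulmx0, mul0mx).
    by rewrite !scaler0 !addr0.
  over.
rewrite !scaler_sumr -!big_split; apply: eq_bigr => i Pi /=.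
have E4 : E i *m E i *m E i *m E i = - (E i *m E i) by rewrite E3// mulNmx.
rewrite mulmxDl !mulmxDr -!scalemxAl -!scalemxAr !mulmxA E4 E3//.
move: (E i) (E i *m E i) => X Y.
apply/matrixP => k l; rewrite !mxE; ring.
Qed.

Lemma planar_mxT d b a : (forall i, P i -> (E i)^T = - E i) ->
  (planar_mx d b a)^T = planar_mx d b (fun i => - a i).
Proof.
move=> sE; rewrite linearD/= tr_scalar_mx linear_sum; congr (_ + _).
apply: eq_bigr => i Pi /=; rewrite linearD/= !linearZ/= trmx_mul sE//.
by rewrite mulNmx mulmxN opprK scalerN scaleNr.
Qed.

Lemma planar_mxJ (J : 'M[R]_n) d b a : J *m J = 1%:M ->
  (forall i, P i -> J *m E i *m J = - E i) ->
  J *m planar_mx d b a *m J = planar_mx d b (fun i => - a i).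
Proof.
move=> JJ sE; rewrite mulmxDr mulmxDl mul_mx_scalar -scalemxAl JJ scalemx1.
congr (_ + _); rewrite mulmx_sumr mulmx_suml.
apply: eq_bigr => i Pi /=; rewrite mulmxDr mulmxDl -!scalemxAr -!scalemxAl.
have -> : J *m (E i *m E i) *m J = (J *m E i *m J) *m (J *m E i *m J).
  by rewrite !mulmxA -(mulmxA _ J J) JJ mulmx1.
by rewrite sE// mulNmx mulmxN opprK scalerN scaleNr.
Qed.

Lemma planar_mx_commJ (J : 'M[R]_n) d b a : J *m J = 1%:M ->
  (forall i, P i -> J *m E i *m J = - E i) ->
  J *m planar_mx d b a = planar_mx d b (fun i => - a i) *m J.
Proof. by move=> JJ sE; rewrite -(planar_mxJ _ _ _ JJ sE) -!mulmxA JJ mulmx1. Qed.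

(** The determinant is nonnegative because the matrix is the square of the one
    with the halved angles. *)
Lemma planar_mx_SO a : (forall i, P i -> (E i)^T = - E i) ->
  SO_set (planar_mx 1 (fun i => cos (a i)) (fun i => sin (a i))).
Proof.
move=> sE.
have orth t : planar_mx 1 (fun i => cos (t i)) (fun i => sin (t i)) *m
   (planar_mx 1 (fun i => cos (t i)) (fun i => sin (t i)))^T = 1%:M.
  rewrite planar_mxT// planar_mxM mulr1 -planar_mx1; apply: eq_planar_mx => i _.
    by rewrite mulrN opprK -!expr2 cos2Dsin2.
  by rewrite mulrN mulrC subrr.
split; first exact: orth.
have [//|d] := orth_det (orth a).
have : planar_mx 1 (fun i => cos (a i)) (fun i => sin (a i)) =
  planar_mx 1 (fun i => cos (a i / 2)) (fun i => sin (a i / 2)) *m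
  planar_mx 1 (fun i => cos (a i / 2)) (fun i => sin (a i / 2)).
  rewrite planar_mxM mulr1; apply: eq_planar_mx => i _.
    by rewrite -cosD -splitr.
  by rewrite -sinD -splitr.
move=> /(congr1 determinant); rewrite det_mulmx d -expr2 => e.
by have := sqr_ge0 (\det (planar_mx 1 (fun i => cos (a i / 2)) (fun i => sin (a i / 2)))); rewrite -e; lra.
Qed.

End Planar.

Section PlaneSystem.
Variables (R : realType) (n : nat) (I : finType) (P : pred I) (u q : I -> 'cV[R]_n).

Definition orthonormal_on (v : I -> 'cV[R]_n) :=
  forall i j, P i -> P j -> (v i)^T *m v j = (i == j)%:R%:M.

Definition plane_gen i := q i *m (u i)^T - u i *m (q i)^T.

Hypotheses (ou : orthonormal_on u) (oq : orthonormal_on q).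
Hypothesis (uq : forall i j, P i -> P j -> (u i)^T *m q j = 0).

Let qu i j : P i -> P j -> (q i)^T *m u j = 0.
Proof. by move=> Pi Pj; rewrite -[LHS]trmxK trmx_mul trmxK uq// trmx0. Qed.

Lemma plane_genM i j : P i -> P j -> plane_gen i *m plane_gen j =
  - ((i == j)%:R *: (u i *m (u j)^T + q i *m (q j)^T)).
Proof.
move=> Pi Pj; rewrite /plane_gen mulmxBl !mulmxBr !mulmxA.
rewrite -!(mulmxA _ (u i)^T) -!(mulmxA _ (q i)^T) uq// ou// qu// oq//.
rewrite !mulmx0 !mul0mx !mul_mx_scalar -!scalemxAl.
by rewrite sub0r subr0 scalerDr opprD addrC.
Qed.

Lemma plane_gen_sqr i : P i -> plane_gen i *m plane_gen i =
  - (u i *m (u i)^T + q i *m (q i)^T).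
Proof. by move=> Pi; rewrite plane_genM// eqxx scale1r. Qed.

Lemma plane_gen_planar : planar P plane_gen.
Proof.
split=> [i j Pi Pj /negPf ij|i Pi].
  by rewrite plane_genM// ij scale0r oppr0.
rewrite plane_gen_sqr// /plane_gen mulNmx mulmxDl !mulmxBr !mulmxA.
rewrite -!(mulmxA _ (u i)^T) -!(mulmxA _ (q i)^T) uq// ou// qu// oq//.
rewrite eqxx !mulmx0 !mul0mx !mulmx1.
by rewrite sub0r subr0 addrC.
Qed.

Lemma plane_genT i : (plane_gen i)^T = - plane_gen i.
Proof. by rewrite linearB/= !trmx_mul !trmxK opprB. Qed.

Lemma plane_genJ (J : 'M[R]_n) i : J^T = J -> J *m u i = - u i -> J *m q i = q i ->
  J *m plane_gen i *m J = - plane_gen i.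
Proof.
move=> sJ Ju Jq; have uJ : (u i)^T *m J = - (u i)^T.
  by rewrite -{1}sJ -trmx_mul Ju linearN.
have qJ : (q i)^T *m J = (q i)^T by rewrite -{1}sJ -trmx_mul Jq.
rewrite /plane_gen mulmxBr mulmxBl !mulmxA Ju Jq !mulNmx -!mulmxA uJ qJ.
by rewrite mulmxN opprK opprB addrC.
Qed.

End PlaneSystem.

(** * The exponential of a planar system *)

Section Sums.
Variable R : realType.

Definition sums_to (V : normedModType R) (f : nat -> V) (l : V) := series f @ \oo --> l.

(** It allows all the convergence questions below to be settled entrywise. *)
Lemma sums_to_mx m n (f : nat -> 'M[R]_(m, n)) (l : 'M[R]_(m, n)) :
  (forall i j, sums_to (fun k => f k i j) (l i j)) -> sums_to f l.
Proof.
move=> fl; apply: cvg_mx => i j.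
have -> : (fun t => series f t i j) = series (fun k => f k i j).
  by apply/funext => N; rewrite /series /= summxE.
exact: fl.
Qed.

Lemma sums_toD (f g : nat -> R) a b : sums_to f a -> sums_to g b ->
  sums_to (fun k => f k + g k) (a + b).
Proof.
by move=> fa gb; rewrite /sums_to (seriesD f g); exact: cvgD.
Qed.

Lemma sums_toN (f : nat -> R) a : sums_to f a -> sums_to (fun k => - f k) (- a).
Proof. by move=> fa; rewrite /sums_to (seriesN f); exact: cvgN. Qed.

Lemma sums_toM (f : nat -> R) a c : sums_to f a -> sums_to (fun k => f k * c) (a * c).
Proof.
move=> fa; rewrite /sums_to.
have -> : series (fun k => f k * c) = (fun N => series f N * c).
  by apply/funext => N; rewrite /series /= mulr_suml.
exact: cvgMr_tmp.
Qed.

Lemma sums_to0 : sums_to (fun=> 0 : R) 0.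
Proof.
rewrite /sums_to (_ : series _ = cst 0); first exact: cvg_cst.
by apply/funext => N; rewrite /series /= big1.
Qed.

Lemma sums_to_sum (I : Type) (r : seq I) (P : pred I) (f : I -> nat -> R) (a : I -> R) :
  (forall i, P i -> sums_to (f i) (a i)) ->
  sums_to (fun k => \sum_(i <- r | P i) f i k) (\sum_(i <- r | P i) a i).
Proof.
move=> fa; elim: r => [|i r IH].
  rewrite big_nil (_ : (fun=> _) = (fun=> 0)); first exact: sums_to0.
  by apply/funext => k; rewrite big_nil.
rewrite big_cons; under [X in sums_to X]eq_fun do rewrite big_cons.
by case: ifP => Pi //; apply: sums_toD => //; exact: fa.
Qed.

Lemma sums_to_delta m : sums_to (fun k => (k == m)%:R : R) 1.
Proof.
apply: cvg_near_cst; exists m.+1 => // N /= mN.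
rewrite /series /= big_mkord (bigD1 (Ordinal mN))//= eqxx big1 ?addr0// => i im.
rewrite -[m]/(val (Ordinal mN)) (inj_eq val_inj).
by rewrite (negPf im).
Qed.

Lemma sums_to_sin x : sums_to (sin_coeff x) (sin x).
Proof. by rewrite /sums_to sin.unlock; exact: is_cvg_series_sin_coeff. Qed.

Lemma sums_to_cos x : sums_to (cos_coeff x) (cos x).
Proof. by rewrite /sums_to cos.unlock; exact: is_cvg_series_cos_coeff. Qed.

Lemma sin_coeffS (x : R) k : sin_coeff x k.+1 = k.+1%:R^-1 * (x * cos_coeff x k).
Proof.
rewrite /sin_coeff /cos_coeff /= factS natrM invfM exprS -!exprnP; ring.
Qed.

Lemma cos_coeffS (x : R) k : cos_coeff x k.+1 = - (k.+1%:R^-1 * (x * sin_coeff x k)).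
Proof.
rewrite /sin_coeff /cos_coeff /= factS natrM invfM exprS negbK.
have [ok|_] := boolP (odd k); last by rewrite !mul0r !mulr0 oppr0.
case: k ok => // k /= ok; rewrite -[(k./2).+1]addn1 !exprnP.
rewrite (_ : (-1) ^ (k./2 + 1)%N = - (-1) ^ k./2 :> R); first by ring.
by rewrite -!exprnP exprD expr1 mulrN1.
Qed.

Lemma cos_coeff0 (x : R) : cos_coeff x 0 = 1.
Proof. by rewrite /cos_coeff /= !mul1r invr1. Qed.

Lemma sin_coeff0 (x : R) : sin_coeff x 0 = 0.
Proof. by rewrite /sin_coeff /= !mul0r. Qed.

End Sums.

Section Exponential.
Variables (R : realType) (n : nat) (I : finType) (P : pred I) (E : I -> 'M[R]_n).
Hypothesis plE : planar P E.
Variables (th : I -> R) (v : 'cV[R]_n).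
Hypothesis th0 : forall i, P i -> th i != 0.

Local Notation T := (planar_mx P E).
Local Notation X := (se_mx (\sum_(i | P i) th i *: E i, v)).

Lemma planar_mxZ c d b a : c *: T d b a = T (c * d) (fun i => c * b i) (fun i => c * a i).
Proof.
rewrite /planar_mx scalerDr scale_scalar_mx scaler_sumr; congr (_ + _).
by apply: eq_bigr => i _; rewrite scalerDr !scalerA mulrBr.
Qed.

Lemma planar_mxD_scalar c d b a : T d b a + c%:M = T (d + c) (fun i => b i + c) a.
Proof.
rewrite /planar_mx addrAC -raddfD /=; congr (_ + _).
by apply: eq_bigr => i _; rewrite opprD addrACA subrr addr0.
Qed.

Lemma sums_to_planar d d' (b b' a a' : I -> _) :
  sums_to d d' -> (forall i, P i -> sums_to (b i) (b' i)) ->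
  (forall i, P i -> sums_to (a i) (a' i)) ->
  forall i j, sums_to (fun k => T (d k) (b^~ k) (a^~ k) i j) (T d' b' a' i j).
Proof.
move=> dd bb aa i j.
have TE d1 b1 a1 : T d1 b1 a1 i j = d1 * (i == j)%:R +
    \sum_(l | P l) (a1 l * E l i j + (d1 - b1 l) * (E l *m E l) i j).
  rewrite /planar_mx mxE summxE mxE mulr_natr; congr (_ + _).
  by apply: eq_bigr => l _; rewrite mxE [X in X + _]mxE [X in _ + X]mxE.
rewrite TE; under [X in sums_to X _]eq_fun do rewrite TE.
apply: sums_toD; first exact: sums_toM.
apply: sums_to_sum => l Pl.
apply: sums_toD; apply: sums_toM; first exact: aa.
by apply: sums_toD => //; apply: sums_toN; exact: bb.
Qed.

(** In the plane of [E i], the rotation block is [(i th)^k / k!], and the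
    translation block is [(i th)^(k-1) / k!], that is, the former divided by
    [i th]; at [k = 0] the subtraction of the Kronecker delta removes the term
    [1 / (i th)], and [k = 1] is the only index contributing on the complement of
    the planes. *)
Definition exp_term k : 'M[R]_(n + 1) :=
  block_mx (T (k == 0)%:R (fun i => cos_coeff (th i) k) (fun i => sin_coeff (th i) k))
    (T (k == 1)%:R (fun i => sin_coeff (th i) k * (th i)^-1)
       (fun i => ((k == 0)%:R - cos_coeff (th i) k) * (th i)^-1) *m v)
    0 (k == 0)%:R%:M.

Lemma exp_termE k : (k`!%:R)^-1 *: X ^+ k = exp_term k.
Proof.
elim: k => [|k IH].
  rewrite expr0 invr1 scale1r /exp_term /=.
  rewrite (_ : (1 : 'M[R]_(n + 1)) = 1%:M)// scalar_mx_block; congr block_mx.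
    by rewrite -(@planar_mx1 R n I P E); apply: eq_planar_mx => i _; rewrite ?cos_coeff0 ?sin_coeff0.
  rewrite (_ : T _ _ _ = 0) ?mul0mx//.
  rewrite /planar_mx raddf0 add0r big1// => i _.
  by rewrite sin_coeff0 cos_coeff0 !subrr !mul0r subrr !scale0r addr0.
rewrite exprS factS natrM invfM -scalerA.
have -> : (k`!%:R)^-1 *: (X * X ^+ k) = X *m ((k`!%:R)^-1 *: X ^+ k) by exact: scalemxAr.
rewrite IH /se_mx /exp_term mulmx_block !mul0mx !mulmx0 !addr0 /=.
rewrite !mul_mx_scalar scale_block_mx !scaler0.
have -> : \sum_(i | P i) th i *: E i = T 0 (fun=> 0) th.
  rewrite /planar_mx raddf0 add0r; apply: eq_bigr => i _.
  by rewrite subrr scale0r addr0.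
rewrite raddf0; congr block_mx; last by rewrite raddf0.
  rewrite planar_mxM// planar_mxZ mul0r mulr0; apply: eq_planar_mx => i Pi.
    by rewrite cos_coeffS; ring.
  by rewrite sin_coeffS; ring.
rewrite mulmxA -[_ *: v]mul_scalar_mx -mulmxDl planar_mxM// planar_mxD_scalar.
rewrite scalemxAl planar_mxZ; congr (_ *m _).
have -> : k.+1%:R^-1 * (0 * (k == 1)%:R + (k == 0)%:R) = (k.+1 == 1)%:R :> R.
  by rewrite mul0r add0r eqSS; case: eqP => [->|_]; rewrite ?invr1 ?mulr0 ?mulr1.
apply: eq_planar_mx => i Pi.
  by rewrite sin_coeffS; field; rewrite th0// gt_eqF// addrC natr1 ltr0n.
by rewrite cos_coeffS; field; rewrite th0// gt_eqF// addrC natr1 ltr0n.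
Qed.

(** The limits of the coordinates of [exp_term] are [e^(i th)] and
    [(e^(i th) - 1) / (i th) = sin th / th + i (1 - cos th) / th]. *)
Lemma expmx_planar : expmx X =
  block_mx (T 1 (fun i => cos (th i)) (fun i => sin (th i)))
    (T 1 (fun i => sin (th i) / th i) (fun i => (1 - cos (th i)) / th i) *m v)
    0 1%:M.
Proof.
rewrite /expmx; apply: cvg_lim => //.
rewrite (_ : (fun k => _) = exp_term); last by apply/funext => k; exact: exp_termE.
apply: sums_to_mx => i j; rewrite /exp_term.
have [i' ->|i' ->] := split_ordP i; have [j' ->|j' ->] := split_ordP j.
- under [X in sums_to X]eq_fun do rewrite block_mxEul.
  rewrite block_mxEul; apply: sums_to_planar => [|k _|k _].
  + exact: sums_to_delta.
  + exact: sums_to_cos.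
  + exact: sums_to_sin.
- under [X in sums_to X]eq_fun do rewrite block_mxEur mxE.
  rewrite block_mxEur mxE; apply: sums_to_sum => l _.
  apply: sums_toM; apply: sums_to_planar => [|k _|k _].
  + exact: sums_to_delta.
  + by apply: sums_toM; exact: sums_to_sin.
  + apply: sums_toM; apply: sums_toD; first exact: sums_to_delta.
    by apply: sums_toN; exact: sums_to_cos.
- under [X in sums_to X]eq_fun do rewrite block_mxEdl mxE.
  by rewrite block_mxEdl mxE; exact: sums_to0.
- rewrite [X in sums_to _ X]block_mxEdr [X in sums_to _ X]mxE -[X in sums_to _ X]mul1r.
  under [X in sums_to X]eq_fun do rewrite block_mxEdr mxE -[_ *+ (i' == j')]mulr_natr.
  apply: sums_toM; exact: sums_to_delta.
Qed.

End Exponential.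

(** * The Lie algebra part and two normal forms *)

Lemma span_ind (F : fieldType) (V : vectType F) (s : seq V) (Q : V -> Prop) :
  Q 0 -> (forall a u w, Q u -> Q w -> Q (a *: u + w)) ->
  (forall u, u \in s -> Q u) -> forall v, v \in span s -> Q v.
Proof.
move=> Q0 Qlin Qs v; rewrite -[s]/(tval (in_tuple s)) => /coord_span ->.
elim/big_rec: _ => // i w _ Qw; apply: Qlin => //.
by apply: Qs; exact: mem_nth.
Qed.

Section LieAlgebra.
Variables (R : realType) (p q : nat).
Local Notation n := (p + q)%N.
Local Notation J := (Jpq R p q).

Lemma J_basis_l (i : 'I_p) : J *m basis_vec R (lshift q i) = - basis_vec R (lshift q i).
Proof.
rewrite JpqE; apply/matrixP => k l; rewrite mul_diag_mx mxE JsignE !mxE.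
by case: eqVneq => [->|_] /=; rewrite ?mulr0 ?oppr0// ltn_ord mulN1r.
Qed.

Lemma J_basis_r (j : 'I_q) : J *m basis_vec R (rshift p j) = basis_vec R (rshift p j).
Proof.
rewrite JpqE; apply/matrixP => k l; rewrite mul_diag_mx mxE JsignE !mxE.
by case: eqVneq => [->|_] /=; rewrite ?mulr0// ltnNge leq_addr mul1r.
Qed.

(** The space [dp] is the [-1]-eigenspace of the differential of [sigma]. *)
Lemma dpP (x : 'M[R]_n * 'cV[R]_n) : dp R p q x <->
  [/\ x.1^T = - x.1, J *m x.1 *m J = - x.1 & J *m x.2 = - x.2].
Proof.
split=> [[x1 x2]|[skx Jx1 Jx2]].
  suff [-> ->] : x.1^T = - x.1 /\ J *m x.1 *m J = - x.1.
    split=> //; apply: (@span_ind _ _ _ (fun y => J *m y = - y) _ _ _ _ x2); first by rewrite mulmx0 oppr0.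
      by move=> a u w Ju Jw; rewrite mulmxDr -scalemxAr Ju Jw scalerN opprD.
    by move=> u /mapP[i _ ->]; exact: J_basis_l.
  apply: (@span_ind _ _ _ (fun y => y^T = - y /\ J *m y *m J = - y) _ _ _ _ x1); first by rewrite trmx0 mulmx0 mul0mx oppr0.
    move=> a u w [u1 u2] [w1 w2]; split.
      by rewrite linearD/= linearZ/= u1 w1 scalerN opprD.
    by rewrite mulmxDr mulmxDl -scalemxAr -scalemxAl u2 w2 scalerN opprD.
  move=> u /allpairsP[[i j] [_ _ ->]] /=; rewrite /wedge; split.
    by rewrite linearB/= !trmx_mul !trmxK opprB.
  have Jl := J_basis_l i; have Jr := J_basis_r j.
  set e := basis_vec R (lshift q i) in Jl *; set f := basis_vec R (rshift p j) in Jr *.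
  have eJ : e^T *m J = - e^T by rewrite -[X in _ *m X]tr_Jpq -trmx_mul Jl linearN.
  have fJ : f^T *m J = f^T by rewrite -[X in _ *m X]tr_Jpq -trmx_mul Jr.
  rewrite mulmxBr mulmxBl !mulmxA Jl Jr !mulNmx -!mulmxA eJ fJ.
  by rewrite mulmxN opprK opprB addrC.
have entry (k l : 'I_n) : (k < p)%N == (l < p)%N -> x.1 k l = 0.
  move=> /eqP kl; have := congr1 (fun M : 'M[R]_n => M k l) Jx1.
  rewrite JpqE mul_mx_diag mxE mul_diag_mx mxE !JsignE [RHS]mxE kl.
  by case: ifP => _; lra.
have entry2 (k : 'I_n) : ~~ (k < p)%N -> x.2 k 0 = 0.
  move=> /negPf kp; have := congr1 (fun M : 'cV[R]_n => M k 0) Jx2.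
  by rewrite JpqE mul_diag_mx mxE JsignE [RHS]mxE kp; lra.
have rp (j : 'I_q) : (rshift p j < p)%N = false by rewrite /= ltnNge leq_addr.
have lp (i : 'I_p) : (lshift q i < p)%N by rewrite /= ltn_ord.
split; last first.
  rewrite (matrix_sum_delta x.2) rpred_sum// => k _.
  rewrite big_ord1; have [i ->|j ->] := split_ordP k; last first.
    by rewrite entry2 ?rp// scale0r mem0v.
  by apply/memvZ/memv_span/mapP; exists i => //; exact: mem_enum.
have -> : x.1 = \sum_(i < p) \sum_(j < q) x.1 (lshift q i) (rshift p j) *:
    wedge R (lshift q i) (rshift p j).
  have dE (k l : 'I_n) : delta_mx k l = basis_vec R k *m (basis_vec R l)^T.
    by rewrite /basis_vec trmx_delta mul_delta_mx.
  rewrite [LHS]matrix_sum_delta big_split_ord /=.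
  under eq_bigr => i _.
    rewrite big_split_ord /= big1 ?add0r => [|j _]; last first.
      by rewrite entry ?scale0r// !lp.
    over.
  rewrite [X in _ + X](_ : _ = \sum_(i < p) \sum_(j < q)
      x.1 (rshift p j) (lshift q i) *: delta_mx (rshift p j) (lshift q i)); last first.
    rewrite [RHS]exchange_big /=; apply: eq_bigr => j _.
    rewrite big_split_ord /= [X in _ + X]big1 ?addr0// => i _.
    by rewrite entry ?scale0r// !rp.
  rewrite -big_split; apply: eq_bigr => i _ /=.
  rewrite -big_split; apply: eq_bigr => j _ /=.
  have -> : x.1 (rshift p j) (lshift q i) = - x.1 (lshift q i) (rshift p j).
    by have := congr1 (fun M : 'M[R]_n => M (lshift q i) (rshift p j)) skx; rewrite !mxE.
  by rewrite !dE scaleNr -scalerBr.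
rewrite rpred_sum// => i _; rewrite rpred_sum// => j _.
apply/memvZ/memv_span/allpairsP; exists (i, j); split=> //; exact: mem_enum.
Qed.

End LieAlgebra.

Section NormalForms.
Variables (R : realType) (p q : nat).
Local Notation n := (p + q)%N.
Local Notation J := (Jpq R p q).

(** The last condition holds when each plane is spanned by a vector of the [-1]
    eigenspace of [J] and one of the [+1] eigenspace. *)
Definition split_planar (I : finType) (P : pred I) (E : I -> 'M[R]_n) :=
  [/\ planar P E, forall i, P i -> (E i)^T = - E i &
      forall i, P i -> J *m E i *m J = - E i].

(** The [u i] and the [w j] are orthogonal because they lie in different
    eigenspaces of the symmetric matrix [J]. *)
Lemma split_plane_gen (I : finType) (P : pred I) (u w : I -> 'cV[R]_n) :
  orthonormal_on P u -> orthonormal_on P w ->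
  (forall i, P i -> J *m u i = - u i) -> (forall i, P i -> J *m w i = w i) ->
  split_planar P (plane_gen u w) /\ (forall i j, P i -> P j -> (u i)^T *m w j = 0).
Proof.
move=> ou ow Ju Jw.
have uw i j : P i -> P j -> (u i)^T *m w j = 0.
  move=> Pi Pj.
  have e : (u i)^T *m w j = - ((u i)^T *m w j).
    rewrite -[in LHS](Jw _ Pj) mulmxA -[in LHS](tr_Jpq R p q) -trmx_mul Ju//.
    by rewrite linearN mulNmx.
  apply/matrixP => k l; have := congr1 (fun M : 'M[R]_1 => M k l) e.
  by rewrite !mxE; lra.
split=> //; split=> [|i Pi|i Pi].
- exact: plane_gen_planar.
- exact: plane_genT.
- by apply: plane_genJ; [exact: tr_Jpq|exact: Ju|exact: Jw].
Qed.

Lemma mx_sum_diag m k (K : 'M[R]_(m, k)) (L : 'M[R]_(m, k)) (c : 'rV[R]_k) :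
  K *m diag_mx c *m L^T = \sum_i c 0 i *: (col i K *m (col i L)^T).
Proof.
apply/matrixP => i j; rewrite mul_mx_diag mxE summxE; apply: eq_bigr => l _.
by rewrite !mxE big_ord1 !mxE mulrAC mulrC mulrA.
Qed.

Lemma col_orth m k (K : 'M[R]_(m, k)) : K^T *m K = 1%:M ->
  forall i j, (col i K)^T *m col j K = (i == j)%:R%:M.
Proof.
move=> KK i j; have := congr1 (fun M : 'M[R]_k => M i j) KK.
rewrite !mxE => e; apply/matrixP => a b; rewrite (ord1 a) (ord1 b) !mxE eqxx mulr1n.
by rewrite -e; apply: eq_bigr => l _; rewrite !mxE.
Qed.

(** The part [M] of [w] mapping the [-1] eigenspace of [J] to the [+1] eigenspace
    satisfies [w = M - M^T]. Its singular value decomposition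
    [M = sum_i c_i k_i l_i^T] gives the planes: for [c_i <> 0] the relations
    [J M = M] and [J M^T = - M^T] force [J k_i = k_i] and [J l_i = - l_i]. *)
Lemma lie_normal_form (w : 'M[R]_n) : w^T = - w -> J *m w *m J = - w ->
  exists (I : finType) (P : pred I) (E : I -> 'M[R]_n) (th : I -> R),
    [/\ split_planar P E, forall i, P i -> th i != 0 &
        w = \sum_(i | P i) th i *: E i].
Proof.
move=> skw Jw; have wJ : w *m J = - (J *m w).
  by rewrite -mulmxN -Jw mulmxA mulmxA JpqK mul1mx.
(* [(1 + J) / 2] is the projection onto the [+1] eigenspace of [J]. *)
pose M := 2^-1 *: (w + J *m w).
have JM : J *m M = M.
  by rewrite -scalemxAr mulmxDr mulmxA JpqK mul1mx addrC.
have MT : M^T = 2^-1 *: (- w + J *m w).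
  by rewrite linearZ/= linearD/= trmx_mul tr_Jpq skw mulNmx wJ opprK.
have JMT : J *m M^T = - M^T.
  by rewrite MT -scalemxAr mulmxDr mulmxN mulmxA JpqK mul1mx -scalerN opprD opprK addrC.
have wE : w = M - M^T.
  rewrite MT -scalerBr opprD opprK addrACA subrr addr0 -mulr2n -[w *+ 2]scaler_nat scalerA.
  by rewrite mulVf ?scale1r.
have [K [L [c [KK LL KML]]]] := svd M.
have KK' := mulmx1C KK; have LL' := mulmx1C LL.
have ME : M = K *m diag_mx c *m L^T.
  by rewrite -KML !mulmxA KK' mul1mx -mulmxA LL' mulmx1.
have ML i : M *m col i L = c 0 i *: col i K.
  rewrite ME -(mulmxA _ L^T); have -> : L^T *m col i L = delta_mx i 0.
    by rewrite colE mulmxA LL mul1mx.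
  rewrite -mulmxA; have -> : diag_mx c *m delta_mx i 0 = c 0 i *: delta_mx i 0 :> 'cV[R]_n.
    apply/matrixP => a b; rewrite mul_diag_mx !mxE.
    by case: eqVneq => [->//|_]; rewrite !mulr0.
  by rewrite -scalemxAr colE.
have MK i : M^T *m col i K = c 0 i *: col i L.
  rewrite ME !trmx_mul trmxK tr_diag_mx -!mulmxA; have -> : K^T *m col i K = delta_mx i 0.
    by rewrite colE mulmxA KK mul1mx.
  have -> : diag_mx c *m delta_mx i 0 = c 0 i *: delta_mx i 0 :> 'cV[R]_n.
    apply/matrixP => a b; rewrite mul_diag_mx !mxE.
    by case: eqVneq => [->//|_]; rewrite !mulr0.
  by rewrite -scalemxAr colE.
pose P := [pred i | c 0 i != 0].
have JK i : P i -> J *m col i K = col i K.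
  move=> Pi; apply: (scalerI Pi); rewrite scalemxAr -ML mulmxA JM//.
have JL i : P i -> J *m col i L = - col i L.
  by move=> Pi; apply: (scalerI Pi); rewrite scalemxAr -MK mulmxA JMT mulNmx scalerN -MK.
have [sp _] := @split_plane_gen _ P (fun i => col i L) (fun i => col i K)
  (fun i j _ _ => col_orth LL i j) (fun i j _ _ => col_orth KK i j) JL JK.
exists 'I_n, P, (plane_gen (fun i => col i L) (fun i => col i K)), (c 0); split=> //.
rewrite {1}wE ME mx_sum_diag linear_sum -sumrB /= [RHS]big_mkcond; apply: eq_bigr => i _.
rewrite linearZ/= trmx_mul trmxK -scalerBr /plane_gen /=.
by case: eqVneq => [->|//]; rewrite scale0r.
Qed.

(** The product of the reflections in two subspaces is a rotation by twice the
    principal angles. Here [u] and [a] are bases of the two subspaces made of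
    principal vectors, [c i] is the cosine of the [i]-th angle [phi], and
    [a i = cos phi u i + sin phi w i] with [w i] a unit vector orthogonal to all
    the [u j]; if [sin phi = 0], the index [i] contributes nothing. *)
Lemma reflections_normal_form (I : finType) (u a : I -> 'cV[R]_n) (c : I -> R) :
  orthonormal_on predT u -> orthonormal_on predT a ->
  (forall i j, (u i)^T *m a j = ((i == j)%:R * c i)%:M) ->
  J = 1%:M - 2 *: \sum_i u i *m (u i)^T ->
  exists (P : pred I) (E : I -> 'M[R]_n) (phi : I -> R),
    [/\ split_planar P E, forall i, P i -> sin (phi i) != 0 /\ phi i != 0 &
        (1%:M - 2 *: \sum_i a i *m (a i)^T) *m J =
        planar_mx P E 1 (fun i => cos (phi i + phi i)) (fun i => sin (phi i + phi i))].
Proof.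
move=> ou oa uac JE.
pose s i := Num.sqrt (1 - c i ^+ 2).
pose y i := a i - c i *: u i.
have ua i j : (a i)^T *m u j = ((i == j)%:R * c i)%:M.
  rewrite -[LHS]trmxK trmx_mul trmxK uac tr_scalar_mx eq_sym.
  by case: eqVneq => [->//|_]; rewrite !mul0r.
have uy i j : (u i)^T *m y j = 0.
  rewrite mulmxBr uac -scalemxAr ou// scale_scalar_mx -raddfB /=.
  by case: eqVneq => [->|_]; rewrite ?(mul0r, mul1r, mulr0, mulr1) subrr raddf0.
have yy i j : (y i)^T *m y j = ((i == j)%:R * (1 - c i ^+ 2))%:M.
  have -> : (y i)^T = (a i)^T - c i *: (u i)^T by rewrite linearB/= linearZ.
  rewrite mulmxBl -scalemxAl uy scaler0 subr0.
  rewrite mulmxBr oa// -scalemxAr ua scale_scalar_mx -raddfB /=; congr (_%:M).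
  by case: eqVneq => [->|_]; rewrite ?mulr1n ?mulr0n; ring.
have c1 i : 0 <= 1 - c i ^+ 2.
  by have := dot_ge0 (y i); rewrite yy eqxx mul1r mxE mulr1n.
have cI i : -1 <= c i <= 1.
  by have := c1 i; rewrite subr_ge0 => c2; apply/andP; split; nra.
have sE i : s i = sin (acos (c i)) by rewrite sin_acos.
have Ju i : J *m u i = - u i.
  rewrite JE mulmxBl mul1mx -scalemxAl mulmx_suml (bigD1 i)//= big1 => [|j ji].
    by rewrite -mulmxA ou// eqxx mulmx1 addr0 scaler_nat mulr2n opprD addrA subrr sub0r.
  by rewrite -mulmxA ou// (negPf ji) raddf0 mulmx0.
have Jy i : J *m y i = y i.
  rewrite JE mulmxBl mul1mx -scalemxAl mulmx_suml big1 ?scaler0 ?subr0// => j _.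
  by rewrite -mulmxA uy mulmx0.
pose P := [pred i | s i != 0].
pose w i := (s i)^-1 *: y i.
have s2 i : s i ^+ 2 = 1 - c i ^+ 2 by rewrite sqr_sqrtr.
have ow : orthonormal_on P w.
  move=> i j Pi Pj; rewrite [(w i)^T]linearZ/= -scalemxAl -scalemxAr yy !scale_scalar_mx.
  congr (_%:M); case: eqVneq => [<-|_]; last by rewrite mul0r !mulr0.
  by rewrite mul1r -s2 mulrA expr2 -invfM mulVf// mulf_neq0.
have oP : orthonormal_on P u by move=> i j _ _; exact: ou.
have Jw i : P i -> J *m w i = w i by move=> _; rewrite -scalemxAr Jy.
have [sp uw] := split_plane_gen oP ow (fun i _ => Ju i) Jw.
exists P, (plane_gen u w), (fun i => acos (c i)); split=> [//|i Pi|].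
  rewrite -sE; split=> //; apply: contraNneq Pi => e.
  by rewrite sE e sin0.
have BJ : (1%:M - 2 *: \sum_i a i *m (a i)^T) *m J =
   1%:M - 2 *: \sum_i (a i *m (a i)^T + u i *m (u i)^T - (2 * c i) *: (a i *m (u i)^T)).
  rewrite {1}JE mulmxBl mul1mx mulmxBr mulmx1 -scalemxAl -scalemxAr.
  have -> : (\sum_i a i *m (a i)^T) *m (\sum_i u i *m (u i)^T) = \sum_i c i *: (a i *m (u i)^T).
    rewrite mulmx_suml; apply: eq_bigr => i _.
    rewrite mulmx_sumr (bigD1 i)//= big1 ?addr0 => [|j ji].
      by rewrite !mulmxA -(mulmxA (a i)) ua eqxx mul1r mul_mx_scalar scalemxAl.
    by rewrite !mulmxA -(mulmxA (a i)) ua eq_sym (negPf ji) mul0r raddf0 mulmx0 mul0mx.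
  rewrite sumrB big_split /=.
  under [X in _ = _ - _ *: (_ - X)]eq_bigr do rewrite -scalerA.
  rewrite -scaler_sumr.
  move: (\sum_i a i *m (a i)^T) (\sum_i u i *m (u i)^T) (\sum_i c i *: _) => A Y Z.
  by apply/matrixP => k l; rewrite !mxE; ring.
(* From here on, only the relation of [w] with [y] is used. *)
have yE i : P i -> y i = s i *: w i by move=> Pi; rewrite scalerA mulfV// scale1r.
clearbody w.
rewrite BJ /planar_mx; congr (_ + _); rewrite -scaleNr scaler_sumr.
rewrite [RHS]big_mkcond; apply: eq_bigr => i _.
have -> : a i = y i + c i *: u i by rewrite subrK.
case: ifP => Pi; last first.
  have si0 : s i = 0 by apply/eqP; move: Pi => /negbFE.
  have y0 : y i = 0.
    by apply/eqP; rewrite -dot_eq0 yy mxE eqxx mul1r -s2 si0 expr0n.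
  have ci : c i ^+ 2 = 1 by apply/eqP; rewrite eq_sym -subr_eq0 -s2 si0 expr0n.
  rewrite y0 add0r linearZ/= -scalemxAr -!scalemxAl !scalerA -mulrA -!expr2 ci.
  by rewrite mulr1 scale1r scaler_nat mulr2n subrr scaler0.
rewrite (plane_gen_sqr oP ow uw)// /plane_gen cosD sinD -sE acosK; last by rewrite in_itv /= cI.
have -> : (y i + c i *: u i)^T = s i *: (w i)^T + c i *: (u i)^T.
  by rewrite yE// [LHS]linearD; congr (_ + _); exact: linearZ.
rewrite yE//.
rewrite !(mulmxDl, mulmxDr) -!scalemxAl -!scalemxAr.
move: (w i *m (w i)^T) (w i *m (u i)^T) (u i *m (w i)^T) (u i *m (u i)^T) => A B C D.
apply/matrixP => k l; rewrite !mxE -!expr2.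
by ring: (s2 i).
Qed.

(** The subspace spanned by the first [p] basis vectors and its image under [A]
    are the two subspaces to which [reflections_normal_form] applies. Their
    principal vectors come from the singular value decomposition of the upper
    left block of [A]. *)
Lemma group_normal_form (A : 'M[R]_n) : A *m A^T = 1%:M ->
  exists (I : finType) (P : pred I) (E : I -> 'M[R]_n) (phi : I -> R),
    [/\ split_planar P E, forall i, P i -> sin (phi i) != 0 /\ phi i != 0 &
        A *m J *m A^T *m J =
        planar_mx P E 1 (fun i => cos (phi i + phi i)) (fun i => sin (phi i + phi i))].
Proof.
move=> AA; have AA' := mulmx1C AA.
have [K [L [c [KK LL KML]]]] := svd (ulsubmx A).
have KK' := mulmx1C KK; have LL' := mulmx1C LL.
pose u i : 'cV[R]_n := col_mx (col i K) 0; pose l i : 'cV[R]_n := col_mx (col i L) 0.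
pose a i := A *m l i.
have JE (M : 'M[R]_p) : M *m M^T = 1%:M ->
    J = 1%:M - 2 *: \sum_i (col_mx (col i M) 0 : 'cV[R]_n) *m (col_mx (col i M) 0 : 'cV[R]_n)^T.
  move=> MM; have -> : \sum_i (col_mx (col i M) 0 : 'cV[R]_n) *m (col_mx (col i M) 0 : 'cV[R]_n)^T
     = block_mx 1%:M 0 0 0.
    have := mx_sum_diag (col_mx M 0 : 'M[R]_(n, p)) (col_mx M 0) (const_mx 1).
    rewrite diag_const_mx mulmx1 tr_col_mx mul_col_row trmx0 !mul0mx !mulmx0 MM => ->.
    by apply: eq_bigr => i _; rewrite mxE scale1r col_col_mx linear0.
  rewrite scale_block_mx !scaler0 scalar_mx_block opp_block_mx add_block_mx !oppr0 !addr0.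
  rewrite /Jpq; congr block_mx.
  by rewrite scaler_nat mulr2n opprD addrA subrr sub0r.
have ou : orthonormal_on predT u.
  move=> i j _ _; rewrite tr_col_mx mul_row_col trmx0 mul0mx addr0.
  exact: col_orth.
have oa : orthonormal_on predT a.
  move=> i j _ _; rewrite trmx_mul mulmxA -(mulmxA _ A^T) AA' mulmx1.
  rewrite tr_col_mx mul_row_col trmx0 mul0mx addr0; exact: col_orth.
have uac i j : (u i)^T *m a j = ((i == j)%:R * c 0 i)%:M.
  rewrite tr_col_mx /a -[A]submxK mul_block_col mul_row_col !mulmx0 !addr0 trmx0 mul0mx addr0.
  have -> : (col i K)^T *m (ulsubmx A *m col j L) =
      delta_mx 0 i *m (K^T *m ulsubmx A *m L) *m delta_mx j 0.
    by rewrite !colE trmx_mul trmx_delta !mulmxA.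
  rewrite KML -rowE -colE; apply/matrixP => x y.
  by rewrite (ord1 x) (ord1 y) !mxE mulr1n mulr_natl.
have [P [E [phi [sp ph BJ]]]] := reflections_normal_form ou oa uac (JE K KK').
exists 'I_p, P, E, phi; split=> //; rewrite -BJ (JE L LL'); congr (_ *m _).
rewrite mulmxBr mulmxBl mulmx1 AA -scalemxAr -scalemxAl; congr (_ - _ *: _).
rewrite mulmx_sumr mulmx_suml; apply: eq_bigr => i _.
by rewrite /a trmx_mul !mulmxA.
Qed.

End NormalForms.

(** * The image of the exponential map *)

Section ExpImage.
Variables (R : realType) (p q : nat).
Local Notation n := (p + q)%N.
Local Notation J := (Jpq R p q).
Local Notation G := (SE R n).

(** With [A] the rotation, [J A^T J = A] by the skew-symmetry of the generators and
    their anticommutation with [J], so that [A J A^T J] is the square of [A]. *)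
Lemma rotation_twist (I : finType) (P : pred I) (E : I -> 'M[R]_n) (f : I -> R) :
  split_planar P E ->
  let T t := planar_mx P E 1 (fun i => cos (t i)) (fun i => sin (t i)) in
  T f *m J *m (T f)^T *m J = T (fun i => f i + f i).
Proof.
move=> [pl sk Js] T.
rewrite -!mulmxA (mulmxA J) /T planar_mxT// planar_mxJ ?JpqK// planar_mxM// mulr1.
apply: eq_planar_mx => i _; rewrite opprK ?cosD ?sinD//.
Qed.

(** With [A] the rotation by the half angles and [Y = Phi v] the translation part
    of the exponential, the point is the image of [(A, Y / 2)]; the relation
    [R J Y = - Y] is [e^(i th) (1 - e^(- i th)) = e^(i th) - 1] in each plane. *)
Lemma exp_dp_Sp x : dp R p q x -> exists2 g : G, Sp R p q g & SE_mx g = expmx (se_mx x).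
Proof.
case: x => w v /dpP /= [skw Jw Jv].
have [I [P [E [th [sp th0 wE]]]]] := lie_normal_form skw Jw.
have [pl sk Js] := sp.
rewrite wE expmx_planar//.
set A := planar_mx P E 1 (fun i => cos (th i / 2)) (fun i => sin (th i / 2)).
have sA : SO_set A by exact: planar_mx_SO.
set Phi := planar_mx P E 1 _ (fun i => _ / _).
have rE : A *m J *m A^T *m J = planar_mx P E 1 (fun i => cos (th i)) (fun i => sin (th i)).
  rewrite rotation_twist//; apply: eq_planar_mx => i _; by rewrite -splitr.
exists (twisted (mkSE (2^-1 *: (Phi *m v)) sA) 1%g); first by exists (mkSE (2^-1 *: (Phi *m v)) sA).
rewrite /SE_mx SE_rot_twisted SE_trans_twisted SE_rot1 SE_trans1 mulmx0 addr0 mulmx1.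
rewrite -[SE_rot _]/A -[SE_trans _]/(2^-1 *: (Phi *m v)) rE; congr block_mx.
have -> : A *m J *m A^T = planar_mx P E 1 (fun i => cos (th i)) (fun i => sin (th i)) *m J.
  by rewrite -rE -[RHS]mulmxA JpqK mulmx1.
have JPhi : J *m Phi = planar_mx P E 1 (fun i => sin (th i) / th i)
    (fun i => - ((1 - cos (th i)) / th i)) *m J.
  exact: planar_mx_commJ (JpqK _ _ _) Js.
rewrite -scalemxAr -[_ *m J *m _]mulmxA (mulmxA J) JPhi -(mulmxA _ J v) Jv !mulmxN mulmxA.
rewrite planar_mxM// mulr1.
rewrite [X in - (X *m v)](_ : _ = Phi); last first.
  apply: eq_planar_mx => i Pi; have t0 := th0 i Pi.
    rewrite mulrN opprK; field; rewrite ?t0//.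
  by rewrite -[X in _ = (X - _) / _](cos2Dsin2 (th i)); field.
rewrite scalerN opprK -scalerDl [X in X *: _](_ : _ = 1) ?scale1r//.
by field.
Qed.

(** With [th = 2 phi], the translation factor [(e^(i th) - 1) / (i th)] equals
    [(sin phi / phi) e^(i phi)]; the vector [v] is the image of the translation
    part under its inverse [(phi / sin phi) e^(- i phi)]. *)
Lemma Sp_exp_dp (g : G) : Sp R p q g -> exists2 x, dp R p q x & expmx (se_mx x) = SE_mx g.
Proof.
move=> gS; have gQ := Sp_Qset gS.
have [_ [A sA gA]] := (SpP g).1 gS.
have [I [P [E [phi [sp ph rE]]]]] := group_normal_form (proj1 sA).
have [pl sk Js] := sp.
have {}rE : SE_rot g = planar_mx P E 1 (fun i => cos (phi i + phi i)) (fun i => sin (phi i + phi i)).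
  by rewrite -rE -gA /reflection -mulmxA JpqK mulmx1.
pose th i := phi i + phi i.
have th0 i : P i -> th i != 0.
  by move=> /ph [_ f0]; rewrite /th -mulr2n mulrn_eq0.
pose v := planar_mx P E 1 (fun i => phi i * cos (phi i) / sin (phi i)) (fun i => - phi i) *m SE_trans g.
exists (\sum_(i | P i) th i *: E i, v).
  apply/dpP; split => /=.
  - rewrite linear_sum -sumrN; apply: eq_bigr => i Pi /=.
    by rewrite linearZ/= sk// scalerN.
  - rewrite mulmx_sumr mulmx_suml -sumrN; apply: eq_bigr => i Pi /=.
    by rewrite -scalemxAr -scalemxAl Js// scalerN.
  - have JY : J *m SE_trans g = - ((SE_rot g)^T *m SE_trans g).
      by have := congr1 (fun h : G => SE_trans h) gQ; rewrite SE_trans_sigma SE_transV.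
    rewrite /v mulmxA.
    have -> : J *m planar_mx P E 1 (fun i => phi i * cos (phi i) / sin (phi i)) (fun i => - phi i) =
       planar_mx P E 1 (fun i => phi i * cos (phi i) / sin (phi i)) (fun i => - - phi i) *m J.
      exact: planar_mx_commJ (JpqK _ _ _) Js.
    rewrite -mulmxA JY mulmxN mulmxA rE planar_mxT// planar_mxM// mulr1.
    congr (- (_ *m _)); apply: eq_planar_mx => i Pi; have [s0 _] := ph i Pi; rewrite ?opprK cosD sinD.
      by rewrite -[in RHS](mulr1 (phi i * _)) -[in RHS](cos2Dsin2 (phi i)); field.
    by rewrite -[RHS]mulr1 -[in RHS](cos2Dsin2 (phi i)); field.
rewrite expmx_planar// /SE_mx -rE; congr block_mx.
rewrite /v mulmxA planar_mxM// mulr1 -[RHS]mul1mx -(planar_mx1 P E).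
congr (_ *m _); apply: eq_planar_mx => i Pi; have [s0 f0] := ph i Pi; have t0 := th0 i Pi.
  rewrite /th cosD sinD -(cos2Dsin2 (phi i)); field.
  by rewrite (t0 : phi i + phi i != 0) s0.
rewrite /th cosD sinD -[X in X - _](cos2Dsin2 (phi i)); field.
by rewrite (t0 : phi i + phi i != 0) s0.
Qed.

End ExpImage.

(** * The orbit as a connected component *)

Section Topology.
Variables (R : realType) (n : nat).
Local Notation G := (SE R n).

Lemma pair_of_continuous : continuous (@pair_of R n).
Proof. exact: initial_continuous. Qed.

Lemma SE_openP (U : set G) : open U <-> exists2 V, open V & U = @pair_of R n @^-1` V.
Proof.
split=> [[V oV <-]|[V oV ->]]; first by exists V.
by exists V.
Qed.

Lemma continuous_SE (T : topologicalType) (f : T -> G) :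
  continuous (fun t => SE_rot (f t)) -> continuous (fun t => SE_trans (f t)) ->
  continuous f.
Proof.
move=> cr ct; apply: continuous_comp_initial.
have -> : set_val \o f = (fun t => (SE_rot (f t), SE_trans (f t))).
  apply/funext => t; rewrite /SE_rot /SE_trans /pair_of /=.
  by rewrite -surjective_pairing.
move=> t.
have := @cvg_pair _ _ _ (nbhs t) (nbhs (SE_rot (f t))) (nbhs (SE_trans (f t))) _ _ _ _ _ (cr t) (ct t).
exact.
Qed.

End Topology.

Section Component.
Variables (R : realType) (p q : nat).
Local Notation n := (p + q)%N.
Local Notation J := (Jpq R p q).
Local Notation G := (SE R n).

Lemma continuous_planar_path (I : finType) (P : pred I) (E : I -> 'M[R]_n) (f : I -> R) :
  continuous (fun t : R => planar_mx P E 1 (fun i => cos (t * f i)) (fun i => sin (t * f i))).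
Proof.
move=> t; apply: cvgD; first exact: cvg_cst.
have ct i : (fun t : R => t * f i) @ t --> t * f i by apply: cvgMr_tmp.
apply: cvg_big => [|i _]; first exact: add_continuous.
apply: cvgD; apply: cvgZr_tmp.
  by apply: (cvg_comp _ _ (ct i)); exact: continuous_sin.
apply: cvgB; first exact: cvg_cst.
by apply: (cvg_comp _ _ (ct i)); exact: continuous_cos.
Qed.

Lemma Sp1 : Sp R p q 1%g.
Proof. by exists 1%g => //; exact: twisted1. Qed.

(** The image of [(A t, t Y / 2)], where [A t] rotates by the angles [t phi]. *)
Lemma Sp_path (g : G) : Sp R p q g ->
  exists f : R -> G, [/\ continuous f, f 0 = 1%g, f 1 = g & forall t, Sp R p q (f t)].
Proof.
move=> gS; have [_ gY] := (QsetP g).1 (Sp_Qset gS).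
have [_ [A sA gA]] := (SpP g).1 gS.
have [I [P [E [phi [sp _ rE]]]]] := group_normal_form (proj1 sA).
have [pl sk Js] := sp.
pose A_ t := planar_mx P E 1 (fun i => cos (t * phi i)) (fun i => sin (t * phi i)).
have sA_ t : SO_set (A_ t) by exact: planar_mx_SO.
pose Y := 2^-1 *: SE_trans g.
pose f t := twisted (mkSE (t *: Y) (sA_ t)) 1%g : G.
have rotf t : SE_rot (f t) = planar_mx P E 1
     (fun i => cos (t * (phi i + phi i))) (fun i => sin (t * (phi i + phi i))).
  rewrite SE_rot_twisted SE_rot1 mulmx1 -[SE_rot _]/(A_ t) rotation_twist//.
  by apply: eq_planar_mx => i _; rewrite mulrDr.
have transf t : SE_trans (f t) = t *: (Y - SE_rot (f t) *m (J *m Y)).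
  rewrite SE_trans_twisted SE_rot1 SE_trans1 mulmx0 addr0 mulmx1 -[SE_trans _]/(t *: Y).
  rewrite SE_rot_twisted SE_rot1 mulmx1 -[SE_rot _]/(A_ t).
  by rewrite -scalemxAr -scalerBr -!mulmxA (mulmxA J J) JpqK mul1mx.
have cr : continuous (fun t => SE_rot (f t)).
  rewrite (_ : (fun t => _) = (fun t => planar_mx P E 1
     (fun i => cos (t * (phi i + phi i))) (fun i => sin (t * (phi i + phi i))))).
    exact: continuous_planar_path.
  exact/funext.
exists f; split.
- apply: continuous_SE => // t; rewrite (_ : (fun t => _) =
    (fun t => t *: (Y - SE_rot (f t) *m (J *m Y)))); last exact/funext.
  apply: cvgZ; first exact: cvg_id.
  apply: cvgB; first exact: cvg_cst.
  apply: cvg_mx => i j; rewrite mxE; under [X in X @ _]eq_fun do rewrite mxE.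
  apply: cvg_big => [|k _]; first exact: add_continuous.
  apply: cvgMr_tmp.
  exact: (cvg_comp (fun t => SE_rot (f t)) (fun M : 'M[R]_n => M i k) (cr t) (@coord_continuous _ _ _ i k _)).
- apply: SE_eq; last by rewrite transf scale0r.
  rewrite rotf SE_rot1 -(planar_mx1 P E); apply: eq_planar_mx => i _.
    by rewrite mul0r cos0.
  by rewrite mul0r sin0.
- have r1 : SE_rot (f 1) = SE_rot g.
    rewrite rotf -[SE_rot g]mulmx1 -(JpqK R p q) mulmxA [SE_rot g *m J]gA rE.
    by apply: eq_planar_mx => i _; rewrite mul1r.
  apply: SE_eq => //; rewrite transf scale1r r1 mulmxA.
  rewrite -/(reflection g) /Y -scalemxAr gY scalerN opprK -scalerDl.
  by rewrite [X in X *: _](_ : _ = 1) ?scale1r//; field.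
- by move=> t; exists (mkSE (t *: Y) (sA_ t)).
Qed.

Definition Sp_nbhd (h : G) : set G :=
  [set g | \det (1%:M + reflection g *m reflection h) != 0].

Lemma Sp_nbhd_open h : open (Sp_nbhd h).
Proof.
have H : continuous (fun x : 'M[R]_n * 'cV[R]_n => \det (1%:M + x.1 *m J *m reflection h)).
  move=> x; apply: smooth_at_continuous; apply: smooth_at_det.
  apply: smooth_mxD; first exact: smooth_mx_cst.
  apply: smooth_mxM; last exact: smooth_mx_cst.
  by apply: smooth_mxM; [exact: smooth_mx_fst|exact: smooth_mx_cst].
apply/SE_openP; exists [set x | \det (1%:M + x.1 *m J *m reflection h) != 0] => //.
rewrite (_ : [set x | _] = (fun x => \det (1%:M + x.1 *m J *m reflection h)) @^-1` [set~ 0]).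
  by apply: open_comp => [x _|]; [exact: H|exact/closed_openC/closed_eq].
by apply/seteqP; split => x /= /eqP.
Qed.

Lemma Sp_nbhd_refl h : Qset R p q h -> Sp_nbhd h h.
Proof.
move=> Qh; rewrite /Sp_nbhd /= reflectionK// -mulr2n -scaler_nat detZ det1 mulr1.
by rewrite expf_neq0// pnatr_eq0.
Qed.

Hypothesis p_gt0 : (0 < p)%N.

(** On a connected subset of Q, membership in the orbit is an open condition by
    [Sp_of_close]; so is the complementary condition, because the relation
    [Sp_nbhd] is symmetric on Q. *)
Lemma Sp_component : Sp R p q = connected_component (Qset R p q) (1%g : G).
Proof.
apply/seteqP; split=> [g gS|g [C [C1 CQ cC] Cg]].
  have [f [cf f0 f1 fS]] := Sp_path gS.
  exists (f @` setT); last by exists 1.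
  split; first by exists 0.
    by move=> _ [t _ <-]; exact/Sp_Qset/fS.
  apply: connected_continuous_connected; last exact: continuous_subspaceT.
  exact/connected_intervalP.
suff : C `&` Sp R p q = C by move=> CE; move: Cg; rewrite -CE => -[].
apply: cC; first by exists 1%g; split => //; exact: Sp1.
- exists (\bigcup_(h in Sp R p q) Sp_nbhd h).
    by apply: bigcup_open => h _; exact: Sp_nbhd_open.
  apply/seteqP; split=> [h [Ch Sh]|h [Ch [k Sk kh]]]; split=> //.
    by exists h => //; exact/Sp_nbhd_refl/CQ.
  by apply: (Sp_of_close p_gt0 (CQ _ Ch) Sk).
- exists (~` \bigcup_(h in Qset R p q `\` Sp R p q) Sp_nbhd h).
    by apply/open_closedC/bigcup_open => h _; exact: Sp_nbhd_open.
  apply/seteqP; split=> [h [Ch Sh]|h [Ch nh]]; split=> //.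
    move=> [k [Qk nSk] kh]; apply: nSk; apply: (Sp_of_close p_gt0 Qk Sh).
    move: kh; rewrite /Sp_nbhd /= -det_tr linearD/= trmx1 trmx_mul.
    by rewrite ((QsetP _).1 Qk).1 ((QsetP _).1 (Sp_Qset Sh)).1.
  apply: contrapT => nSh; apply: nh; exists h; first by split=> //; exact: CQ.
  exact/Sp_nbhd_refl/CQ.
Qed.

End Component.

(** * Local sections of the orbit map *)

Section LocalSection.
Variables (R : realType) (p q : nat).
Local Notation n := (p + q)%N.
Local Notation J := (Jpq R p q).
Local Notation G := (SE R n).
Local Notation V := ('M[R]_n * 'cV[R]_n)%type.

(** The section at the identity sends [(R, Y)] to the orthonormalization of
    [C = (1 + R) / 2] together with [Y / 2]. At [g0] it is conjugated by the
    translation by [g0]: the pair [(R1 x, T1 x)] is [x] moved back by the twisted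
    action of [g0^-1], written in the ambient space. *)
Lemma local_section (g0 : G) : exists (W : set V) (S : V -> V),
  let x0 := pair_of (twisted g0 1%g) in
  [/\ open W /\ W x0, smooth_mx_at x0 (fun x => (S x).1),
      smooth_mx_at x0 (fun x => (S x).2), S x0 = pair_of g0 &
      forall s : G, Sp R p q s -> W (pair_of s) ->
        exists2 g : G, pair_of g = S (pair_of s) & twisted g 1%g = s].
Proof.
pose A0 := SE_rot g0; pose X0 := SE_trans g0.
pose R1 (x : V) := A0^T *m x.1 *m J *m A0 *m J.
pose T1 (x : V) := A0^T *m (x.2 - X0 + x.1 *m J *m X0).
pose C x := 2^-1 *: (1%:M + R1 x).
pose A1 x := orthonormalize (C x).
pose S (x : V) : V := (A0 *m A1 x, X0 + A0 *m (2^-1 *: T1 x)).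
set x0 := pair_of (twisted g0 1%g).
have rot1 s : R1 (pair_of s) = SE_rot (twisted g0^-1%g s).
  by rewrite SE_rot_twisted SE_rotV trmxK.
have trans1 s : T1 (pair_of s) = SE_trans (twisted g0^-1%g s).
  rewrite SE_trans_twisted SE_rotV SE_transV trmxK /T1 mulmxN opprK.
  rewrite !mulmxDr mulmxN -!mulmxA (mulmxA A0) SE_rotK mul1mx -/X0.
  by rewrite [- _ + _]addrC.
have g0K : twisted g0^-1%g (twisted g0 1%g) = 1%g :> G.
  by rewrite -twistedM mulVg twisted1.
have R1x0 : R1 x0 = 1%:M by rewrite rot1 g0K.
have T1x0 : T1 x0 = 0 by rewrite trans1 g0K.
have Cx0 : C x0 = 1%:M.
  rewrite /C R1x0 scalerDr -scalerDl [X in X *: _](_ : _ = 1) ?scale1r//.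
  by field.
have A1x0 : A1 x0 = 1%:M by rewrite /A1 Cx0 orthonormalize1.
have s1 : smooth_mx_at x0 fst by exact: smooth_mx_fst.
have s2 : smooth_mx_at x0 snd by exact: smooth_mx_snd.
have sc k l (M : 'M[R]_(k, l)) : smooth_mx_at x0 (fun=> M) by exact: smooth_mx_cst.
have sC : smooth_mx_at x0 C.
  apply: smooth_mxZ; first exact: smooth_at_cst.
  by apply: smooth_mxD => //; do 4 apply: smooth_mxM => //.
have sA1 : smooth_mx_at x0 A1.
  apply: smooth_mxM => //; apply: smooth_mxT; apply: smooth_inv_cholesky.
    by apply: smooth_mxM => //; exact: smooth_mxT.
  by apply: gram_posdef; rewrite Cx0 unitmx1.
have sT : smooth_mx_at x0 T1.
  apply: smooth_mxM => //; apply: smooth_mxD; first exact: smooth_mxD.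
  by do 2 apply: smooth_mxM => //.
(* The first condition makes [C x] invertible, the second one excludes the
   orthogonal matrices of determinant [-1]. *)
pose W := interior [set x | \det (C x) != 0 /\ 0 < \det (A1 x)].
exists W, S; split.
- split; first exact: open_interior.
  apply: filterI.
    have : {for x0, continuous (fun x => \det (C x))}.
      exact/smooth_at_continuous/smooth_at_det.
    by move=> /cvgr_neq0; apply; rewrite Cx0 det1 oner_neq0.
  have : {for x0, continuous (fun x => \det (A1 x))}.
    exact/smooth_at_continuous/smooth_at_det.
  by move=> /cvgr_gt; apply; rewrite A1x0 det1 ltr01.
- exact: smooth_mxM.
- apply: smooth_mxD => //; apply: smooth_mxM => //; apply: smooth_mxZ => //.
  exact: smooth_at_cst.
- rewrite /S A1x0 T1x0 mulmx1 scaler0 mulmx0 addr0.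
  by rewrite /A0 /X0 /SE_rot /SE_trans -surjective_pairing.
- move=> s sS /interior_subset /= [dC dA].
  have s1S := Sp_twisted g0^-1%g sS.
  have [sym anti] := (QsetP _).1 (Sp_Qset s1S).
  have uC : C (pair_of s) \in unitmx by rewrite unitmxE unitfE.
  have BC : reflection (twisted g0^-1%g s) *m C (pair_of s) = C (pair_of s) *m J.
    rewrite /C rot1 -scalemxAr -scalemxAl; congr (_ *: _).
    rewrite mulmxDr mulmx1 mulmxDl mul1mx -/(reflection (twisted g0^-1%g s)).
    rewrite -[X in _ + _ *m X]mulmx1 -(JpqK R p q) [SE_rot _ *m _]mulmxA.
    rewrite -/(reflection (twisted g0^-1%g s)) mulmxA reflectionK; last exact: Sp_Qset.
    by rewrite mul1mx addrC.
  have oA := orthonormalize_orth uC.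
  have BA := orthonormalize_intertwine uC sym BC.
  have sA : SO_set (A1 (pair_of s)).
    split=> //; have [//|dA1] := orth_det oA.
    by move: dA; rewrite /A1 dA1 ltr0N1.
  exists (g0 * mkSE (2^-1 *: T1 (pair_of s)) sA)%g => //.
  have gs : twisted g0 (twisted g0^-1%g s) = s by rewrite -twistedM mulgV twisted1.
  rewrite -[RHS]gs twistedM; congr (twisted g0 _).
  apply: SE_eq.
    rewrite SE_rot_twisted SE_rot1 mulmx1 -[SE_rot _]/(A1 (pair_of s)).
    by rewrite -BA -[_ *m _ *m _^T]mulmxA oA mulmx1 /reflection -mulmxA JpqK mulmx1.
  rewrite SE_trans_twisted SE_rot1 SE_trans1 mulmx1 mulmx0 addr0.
  rewrite -[SE_rot _]/(A1 (pair_of s)) -[SE_trans _]/(2^-1 *: T1 (pair_of s)).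
  rewrite -BA -[_ *m _ *m _^T]mulmxA oA mulmx1 trans1 -scalemxAr anti.
  rewrite scalerN opprK -scalerDl [X in X *: _](_ : _ = 1) ?scale1r//.
  by field.
Qed.

End LocalSection.

(** * The orbit map and the theorem *)

Section OrbitMap.
Variables (R : realType) (p q : nat).
Local Notation n := (p + q)%N.
Local Notation J := (Jpq R p q).
Local Notation G := (SE R n).
Local Notation V := ('M[R]_n * 'cV[R]_n)%type.
Local Notation S := (set_type (Sp R p q)).
Local Notation homog := (homog R p q).

Lemma orbit_point_subproof (g : G) : twisted g 1%g \in Sp R p q.
Proof. by apply/mem_set; exists g. Qed.

Definition orbit_point (g : G) : S := exist _ (twisted g 1%g) (orbit_point_subproof g).

Lemma val_orbit_point g : \val (orbit_point g) = twisted g 1%g. Proof. by []. Qed.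

(** Both conditions say that [g^-1 h] is fixed by [sigma]. *)
Lemma orbit_point_eq g h : orbit_point g = orbit_point h <-> homog_pi g = homog_pi h :> homog.
Proof.
have E : twisted g 1%g = twisted h 1%g <-> SE_sigma (g^-1 * h)%g.
  rewrite /twisted !mulg1 !sigmaV /SE_sigma /= sigmaM sigmaV; split=> e.
    by apply: (mulgI g); rewrite mulVKg mulgA e mulgVK.
  by apply: (mulIg (sigma h)); rewrite mulgVK -mulgA e mulVKg.
split=> [/(congr1 \val)|].
  by rewrite !val_orbit_point => /E e; apply/eqmodP/asboolP.
by move=> /eqmodP/asboolP/E e; apply: val_inj.
Qed.

Definition orbit_map (C : homog) : S := orbit_point (repr (C : {eq_quot (coset_equiv R p q)})).

Lemma orbit_mapE g : orbit_map (homog_pi g) = orbit_point g.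
Proof. by apply/orbit_point_eq; exact: reprK. Qed.

Lemma orbit_point_surj (s : S) : exists g, orbit_point g = s.
Proof.
have [g _ gs] : Sp R p q (\val s) by case: s => s sS; exact: set_mem.
by exists g; apply: val_inj.
Qed.

Definition orbit_inv (s : S) : homog := homog_pi (sval (cid (orbit_point_surj s))).

Lemma orbit_inv_point g : orbit_inv (orbit_point g) = homog_pi g.
Proof. by apply/orbit_point_eq; exact: (svalP (cid (orbit_point_surj (orbit_point g)))). Qed.

Lemma orbit_mapK : cancel orbit_map orbit_inv.
Proof. by move=> C; rewrite /orbit_map orbit_inv_point; exact: reprK. Qed.

Lemma orbit_invK : cancel orbit_inv orbit_map.
Proof. by move=> s; have [g <-] := orbit_point_surj s; rewrite orbit_inv_point orbit_mapE. Qed.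

(** A polynomial extension of [g |-> twisted g 1] to the ambient vector space. *)
Definition ambient_orbit_point (x : V) : V :=
  (x.1 *m J *m x.1^T *m J, x.2 - x.1 *m J *m x.1^T *m x.2).

Lemma ambient_orbit_pointE (g : G) : ambient_orbit_point (pair_of g) = pair_of (twisted g 1%g).
Proof.
apply: injective_projections; rewrite -/(SE_rot _) -/(SE_trans _).
  by rewrite SE_rot_twisted SE_rot1 mulmx1.
by rewrite [RHS]SE_trans_twisted SE_rot1 SE_trans1 mulmx0 addr0 mulmx1.
Qed.

Lemma smooth_ambient_orbit_point (x : V) : smooth_mx_at x (fun y => (ambient_orbit_point y).1) /\
  smooth_mx_at x (fun y => (ambient_orbit_point y).2).
Proof.
have s1 : smooth_mx_at x fst by exact: smooth_mx_fst.
have s2 : smooth_mx_at x snd by exact: smooth_mx_snd.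
have sJ : smooth_mx_at x (fun=> J) by exact: smooth_mx_cst.
have s3 : smooth_mx_at x (fun y => y.1 *m J *m y.1^T).
  by apply: smooth_mxM; [exact: smooth_mxM|exact: smooth_mxT].
split; first exact: smooth_mxM.
by apply: smooth_mxD => //; apply: smooth_mxN; exact: smooth_mxM.
Qed.

Lemma orbit_point_continuous : continuous orbit_point.
Proof.
apply: continuous_comp_initial; apply: continuous_SE.
  rewrite (_ : (fun g => _) = (fun g => (ambient_orbit_point (pair_of g)).1)); last first.
    by apply/funext => g; rewrite ambient_orbit_pointE.
  move=> g; apply: (@continuous_comp _ _ _ (@pair_of R n) (fun y => (ambient_orbit_point y).1)).
    exact: pair_of_continuous.
  exact/smooth_mx_continuous/(smooth_ambient_orbit_point _).1.
rewrite (_ : (fun g => _) = (fun g => (ambient_orbit_point (pair_of g)).2)); last first.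
  by apply/funext => g; rewrite ambient_orbit_pointE.
move=> g; apply: (@continuous_comp _ _ _ (@pair_of R n) (fun y => (ambient_orbit_point y).2)).
  exact: pair_of_continuous.
exact/smooth_mx_continuous/(smooth_ambient_orbit_point _).2.
Qed.

Lemma orbit_map_continuous : continuous orbit_map.
Proof.
apply/quotient_continuous.
rewrite (_ : _ \o _ = orbit_point); first exact: orbit_point_continuous.
by apply/funext => g; exact: orbit_mapE.
Qed.

(** Near the image of [g0], the inverse is a local section at [g0] followed by the
    projection to the cosets. *)
Lemma orbit_inv_continuous : continuous orbit_inv.
Proof.
apply/continuousP => A oA; rewrite openE => s0 As0.
have [g0 gs0] := orbit_point_surj s0.
have := oA; rewrite /open /= /quotient_open => /SE_openP[U oU piA].
have [W [T [[oW Wx0] s1 s2 Tx0 WT]]] := local_section g0.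
have cT := smooth_pair_continuous s1 s2.
have UT : U (T (pair_of (twisted g0 1%g))).
  rewrite Tx0 -[U _]/((@pair_of R n @^-1` U) g0) -piA /=.
  by move: As0; rewrite /= -gs0 orbit_inv_point.
have cs : continuous (fun s : S => pair_of (\val s)).
  move=> s; apply: (@continuous_comp _ _ _ (\val : S -> G) (@pair_of R n)).
    exact: initial_continuous.
  exact: pair_of_continuous.
have N : \forall s \near s0, (W `&` T @^-1` U) (pair_of (\val s)).
  apply: cs; rewrite -gs0; apply: filterI; first exact: open_nbhs_nbhs.
  by apply: cT; exact: open_nbhs_nbhs.
apply: filterS N => s [Ws Us].
have [|g gT gs] := WT (\val s) _ Ws; first by case: s {Ws Us} => s sS; exact: set_mem.
have <- : orbit_point g = s by exact: val_inj.
rewrite /= orbit_inv_point -[A _]/((\pi_{eq_quot (coset_equiv R p q)} @^-1` A) g) piA /=.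
by rewrite gT.
Qed.

(** A local extension of a function on the orbit is composed with the polynomial
    extension of the orbit map in one direction, and a local extension of its
    pullback is composed with a local section in the other. *)
Lemma orbit_map_smooth (U : set S) (f : S -> R) : open U ->
  (Sp_smooth R p q U f <-> homog_smooth R p q (orbit_map @^-1` U) (f \o orbit_map)).
Proof.
move=> oU; split=> [sf g /= Ug|sf s0 Us0].
  rewrite orbit_mapE in Ug.
  have [W [h [/SE_openP[W0 oW0 ->] Wg sh fh]]] := sf _ Ug.
  have [W1 [h1 [oW1 W1g sh1 hh1]]] := sh _ Wg.
  have [sm1 sm2] := smooth_ambient_orbit_point (pair_of g).
  have [||W2 [oW2 W2g W2sub sW2]] := smooth_comp (U := W1 `&` W0) (h := h1) sm1 sm2 (openI oW1 oW0).
  - by rewrite ambient_orbit_pointE.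
  - by move=> k; apply: Ck_sub (sh1 k) => x [].
  exists W2, (h1 \o ambient_orbit_point); split=> // y /= Uy W2y.
  rewrite orbit_mapE in Uy *.
  have [W1y W0y] := W2sub _ W2y; rewrite ambient_orbit_pointE in W1y W0y *.
  by rewrite fh// val_orbit_point hh1.
have [g0 gs0] := orbit_point_surj s0.
have Ug0 : ((@homog_pi R p q) @^-1` (orbit_map @^-1` U)) g0 by rewrite /= orbit_mapE gs0.
have [W1 [h1 [oW1 W1g sh1 fh1]]] := sf _ Ug0.
have [W [T [[oW Wx0] s1 s2 Tx0 WT]]] := local_section g0.
have [||W2 [oW2 W2g W2sub sW2]] := smooth_comp (U := W1) (h := h1) s1 s2 oW1.
- by rewrite Tx0.
- exact: sh1.
pose W3 := W `&` W2.
exists (@pair_of R n @^-1` W3), (fun g => (h1 \o T) (pair_of g)); split.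
- by apply/SE_openP; exists W3 => //; exact: openI.
- by rewrite -gs0.
- move=> x Wx; exists W3, (h1 \o T); split=> //; first exact: openI.
  by move=> k; apply: Ck_sub (sW2 k) => y [].
- move=> s Us [Ws W2s].
  have [|g gT gs] := WT (\val s) _ Ws; first by case: s {Us Ws W2s} => s sS; exact: set_mem.
  have es : orbit_point g = s by exact: val_inj.
  rewrite /= -gT -fh1 /=; last first.
  + by rewrite gT; exact: W2sub.
  + by rewrite orbit_mapE es.
  by rewrite orbit_mapE es.
Qed.

Lemma orbit_map_diffeomorphism :
  diffeomorphism (homog_smooth R p q) (Sp_smooth R p q) orbit_map.
Proof.
split; first exact: orbit_map_continuous.
  exists orbit_inv; split; [exact: orbit_mapK|exact: orbit_invK|].
  exact: orbit_inv_continuous.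
exact: orbit_map_smooth.
Qed.

Lemma orbit_map_equivariant (g : G) (C : homog) :
  \val (orbit_map (left_translation g C)) = twisted g (\val (orbit_map C)).
Proof. by rewrite /left_translation orbit_mapE !val_orbit_point twistedM. Qed.

Lemma Sp_explicit : [set pair_of g | g in Sp R p q] =
  [set (x.1 *m J *m invmx x.1 *m J, x.2 - x.1 *m J *m invmx x.1 *m x.2)
        | x in SE_set R n].
Proof.
have inv g : invmx (SE_rot g) = (SE_rot g)^T :> 'M[R]_n.
  have u : SE_rot g \in unitmx by rewrite unitmxE; case: (rot_SO g) => _ ->; exact: unitr1.
  by rewrite -[LHS]mulmx1 -(SE_rotK g) mulmxA mulVmx// mul1mx.
apply/seteqP; split=> [_ [_ [g _ <-] <-]|_ [x xSE <-]].
  by exists (pair_of g); [exact: rot_SO|rewrite inv -ambient_orbit_pointE].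
exists (twisted (mkSE x.2 (xSE : SO_set x.1)) 1%g); first by exists (mkSE x.2 (xSE : SO_set x.1)).
rewrite -ambient_orbit_pointE /ambient_orbit_point /=.
by have /= -> := inv (mkSE x.2 (xSE : SO_set x.1)).
Qed.

End OrbitMap.

Theorem theorem1 (R : realType) (p q : nat) (hp : (1 <= p)%N) (hq : (1 <= q)%N) :
  [/\ [set pair_of g | g in Sp R p q] =
        [set (x.1 *m Jpq R p q *m invmx x.1 *m Jpq R p q,
              x.2 - x.1 *m Jpq R p q *m invmx x.1 *m x.2)
        | x in SE_set R (p + q)],
      exists F : homog R p q -> set_type (Sp R p q),
        diffeomorphism (homog_smooth R p q) (Sp_smooth R p q) F /\
        forall (g : SE R (p + q)) (C : homog R p q),
          \val (F (left_translation g C)) = twisted g (\val (F C)),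
      Sp R p q = connected_component (Qset R p q) (1%g : SE R (p + q)) &
      [set SE_mx g | g in Sp R p q] = [set expmx (se_mx x) | x in dp R p q]].
Proof.
split.
- exact: Sp_explicit.
- exists (@orbit_map R p q); split; first exact: orbit_map_diffeomorphism.
  exact: orbit_map_equivariant.
- exact: Sp_component.
- apply/seteqP; split=> [_ [g /Sp_exp_dp [x xd xg] <-]|_ [x /exp_dp_Sp [g gS gx] <-]].
    by exists x.
  by exists g.
Qed.
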